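(* Let $\mathcal{H}$ be a complex Hilbert space and let $T\in\mathcal{B}(\mathcal{H})$ be a concave operator. Then: (i) $T$ has a $2$-isometric lifting $S$ on a Hilbert space $\mathcal{K}=\mathcal{H}^{\perp}\oplus\mathcal{H}$ with covariance ${\rm cov}(S)=\sqrt{2}\,\max\{1,\|\Delta_T\|^{1/2}\}$ and having a block matrix of the form $$S=\begin{pmatrix} W & X\\ 0 & T\end{pmatrix}\ \text{on}\ \begin{bmatrix}\mathcal{H}^{\perp}\\ \mathcal{H}\end{bmatrix},\qquad W=\begin{pmatrix} S_+^1 & \sqrt{2}E_0\\ 0 & S_+^0\end{pmatrix}\ \text{on}\ \begin{bmatrix}\mathcal{H}_1\\ \mathcal{H}_0\end{bmatrix},\qquad W^*X=0,$$ where $W$ is a $2$-isometry on a nontrivial decomposition $\mathcal{H}^{\perp}=\mathcal{H}_1\oplus\mathcal{H}_0$, $S_+^1$ and $S_+^0$ are unilateral shifts (on $\mathcal{H}_1$ and $\mathcal{H}_0$ respectively), $E_0:\mathcal{H}_0\to\mathcal{H}_1$ is an isometry, and $X:\mathcal{H}\to\mathcal{H}^\perp$ is a bounded operator. (ii) $T$ has a minimal $2$-isometric lifting $S$ on some $\mathcal{K}=\mathcal{H}^\perp\oplus\mathcal{H}$, of the form $S=\begin{pmatrix} W & X\\ 0 & T\end{pmatrix}$ on $\mathcal{H}^\perp\oplus\mathcal{H}$, where $W=S|_{\mathcal{H}^{\perp}}$ is an isometry, $W^*X=0$, and ${\rm cov}(S)=\|\Delta_T\|^{1/2}$.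
   Context: For $T\in\mathcal{B}(\mathcal{H})$ put $\Delta_T=T^*T-I$. $T$ is concave if $T^{*2}T^2-2T^*T+I\le 0$, and a $2$-isometry if $T^{*2}T^2-2T^*T+I=0$. For a $2$-isometry $S$, the covariance is ${\rm cov}(S)=\|\Delta_S\|^{1/2}$. If $\mathcal{H}$ is a closed subspace of $\mathcal{K}$, an operator $S\in\mathcal{B}(\mathcal{K})$ is a lifting of $T$ if $P_{\mathcal{H}}S=TP_{\mathcal{H}}$ (equivalently $\mathcal{H}$ is invariant for $S^*$ and $S^*|_{\mathcal{H}}=T^*$). A lifting $S$ is minimal if $\mathcal{K}=\bigvee_{n\ge0}S^n\mathcal{H}$ (closed linear span). *)

(* Defs.v *)
From HB Require Import structures.
From mathcomp Require Import all_boot all_order all_algebra.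
From mathcomp Require Import complex.
From mathcomp Require Import boolp classical_sets reals.
From Stdlib Require Import ClassicalEpsilon.

Set Implicit Arguments.
Unset Strict Implicit.
Unset Printing Implicit Defensive.
Import Order.TTheory GRing.Theory Num.Theory.
Local Open Scope ring_scope.

Section InnerNorm.
Variables (R : realType) (V : lmodType R[i]) (ip : V -> V -> R[i]).

Definition ip_norm (x : V) : R := Num.sqrt (complex.Re (ip x x)).

Definition ip_cvg_to (u : nat -> V) (l : V) : Prop :=
  forall e : R, 0 < e -> exists N : nat, forall n, (N <= n)%N ->
    ip_norm (u n - l) < e.

Definition ip_cauchy (u : nat -> V) : Prop :=
  forall e : R, 0 < e -> exists N : nat, forall m n, (N <= m)%N -> (N <= n)%N ->
    ip_norm (u m - u n) < e.
End InnerNorm.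

Record hilbert (R : realType) := Hilbert {
  hsort :> lmodType R[i];
  hinner : hsort -> hsort -> R[i];
  hinnerDl : forall (a : R[i]) (x y z : hsort),
      hinner (a *: x + y) z = a * hinner x z + hinner y z;
  hinner_conj : forall x y : hsort, hinner y x = conjc (hinner x y);
  hinner_ge0 : forall x : hsort, 0 <= hinner x x;
  hinner_eq0 : forall x : hsort, hinner x x = 0 -> x = 0;
  hcomplete : forall u : nat -> hsort, ip_cauchy hinner u ->
      exists l, ip_cvg_to hinner u l
}.

Section Operators.
Variable R : realType.

Definition hnorm {K : hilbert R} (x : K) : R := ip_norm (@hinner R K) x.
Definition cvg_to {K : hilbert R} (u : nat -> K) (l : K) := ip_cvg_to (@hinner R K) u l.

Definition bounded_op {K1 K2 : hilbert R} (A : K1 -> K2) : Prop :=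
  (forall (a : R[i]) (x y : K1), A (a *: x + y) = a *: A x + A y) /\
  exists M : R, forall x, hnorm (A x) <= M * hnorm x.

Definition is_adjoint {K1 K2 : hilbert R} (A : K1 -> K2) (B : K2 -> K1) : Prop :=
  forall x y, hinner (A x) y = hinner x (B y).

Definition adj {K1 K2 : hilbert R} (A : K1 -> K2) : K2 -> K1 :=
  epsilon (inhabits (fun _ => 0)) (is_adjoint A).

Definition opnorm {K1 K2 : hilbert R} (A : K1 -> K2) : R :=
  sup (fun r : R => exists x : K1, hnorm x <= 1 /\ r = hnorm (A x)).

Definition op_le {K : hilbert R} (A B : K -> K) : Prop :=
  forall x, 0 <= hinner (B x - A x) x.

Definition Delta {K : hilbert R} (T : K -> K) : K -> K :=
  fun x => adj T (T x) - x.

Definition second_diff {K : hilbert R} (T : K -> K) : K -> K :=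
  fun x => adj T (adj T (T (T x))) - (adj T (T x)) *+ 2 + x.

Definition concave_op {K : hilbert R} (T : K -> K) : Prop :=
  op_le (second_diff T) (fun _ => 0).

Definition two_isometry {K : hilbert R} (S : K -> K) : Prop :=
  forall x, second_diff S x = 0.

Definition cov {K : hilbert R} (S : K -> K) : R := Num.sqrt (opnorm (Delta S)).

Definition is_isometry {K1 K2 : hilbert R} (V : K1 -> K2) : Prop :=
  forall x, adj V (V x) = x.

Definition range_of {K1 K2 : hilbert R} (A : K1 -> K2) : set K2 :=
  fun k => exists x, k = A x.

Definition orth {K : hilbert R} (A : set K) : set K :=
  fun k => forall a, A a -> hinner k a = 0.

Definition span_of {K : hilbert R} (A : set K) : set K :=
  fun x => exists s : seq (R[i] * K),
    (forall p, p \in s -> A p.2) /\ x = \sum_(p <- s) p.1 *: p.2.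

Definition cspan {K : hilbert R} (A : set K) : set K :=
  fun k => exists u : nat -> K, (forall n, span_of A (u n)) /\ cvg_to u k.

Definition closed_subspace {K : hilbert R} (L : set K) : Prop :=
  L 0 /\ (forall (a : R[i]) x y, L x -> L y -> L (a *: x + y)) /\
  (forall u l, (forall n, L (u n)) -> cvg_to u l -> L l).

(* unilateral shift: an isometry V with a wandering subspace L
   (V^m L orthogonal to V^n L for m <> n) such that K = (+)_{n>=0} V^n L *)
Definition unilateral_shift {K : hilbert R} (V : K -> K) : Prop :=
  bounded_op V /\ is_isometry V /\
  exists L : set K, closed_subspace L /\
    (forall m n, m <> n -> forall a b, L a -> L b ->
        hinner (iter m V a) (iter n V b) = 0) /\
    (forall k, cspan (fun y => exists n a, L a /\ y = iter n V a) k).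

(* J : H -> K identifies H with a closed subspace of K *)
Definition embedding {K1 K2 : hilbert R} (J : K1 -> K2) : Prop :=
  bounded_op J /\ is_isometry J.

(* K = range Jp (+) range J, orthogonal decomposition:
   range Jp is exactly the orthogonal complement of range J *)
Definition orth_decomp {K1 K2 K : hilbert R} (Jp : K1 -> K) (J : K2 -> K) : Prop :=
  embedding Jp /\ embedding J /\ range_of Jp = orth (range_of J).

(* S is a lifting of T (H identified with range J, P_H = J J^* ):
   P_H S = T P_H *)
Definition lifting {H K : hilbert R} (J : H -> K) (S : K -> K) (T : H -> H) : Prop :=
  forall k, J (adj J (S k)) = J (T (adj J (k))).

Definition minimal_lifting {H K : hilbert R} (J : H -> K) (S : K -> K) : Prop :=
  forall k, cspan (fun y => exists n h, y = iter n S (J h)) k.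

(* S = [[A, B], [0, D]] on K = range J1 (+) range J2 *)
Definition upper_block {K1 K2 K : hilbert R} (J1 : K1 -> K) (J2 : K2 -> K)
  (S : K -> K) (A : K1 -> K1) (B : K2 -> K1) (D : K2 -> K2) : Prop :=
  (forall u, S (J1 u) = J1 (A u)) /\
  (forall v, S (J2 v) = J1 (B v) + J2 (D v)).

Definition nontrivial (K : hilbert R) : Prop := exists x : K, x != 0.

End Operators.

(* Main.v *)
Require Import Defs.
From HB Require Import structures.
From mathcomp Require Import all_boot all_order all_algebra.
From mathcomp Require Import complex.
From mathcomp Require Import boolp classical_sets functions reals.
From mathcomp Require Import topology normedtype sequences.
From mathcomp Require Import ring lra.
From Stdlib Require Import ClassicalEpsilon.
Import Defs.

Set Implicit Arguments.
Unset Strict Implicit.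
Unset Printing Implicit Defensive.
Import Order.TTheory GRing.Theory Num.Theory.
Import numFieldNormedType.Exports.
Local Open Scope ring_scope.
Local Open Scope complex_scope.
Local Open Scope classical_set_scope.

(** Write [delta x = |T x|^2 - |x|^2].  Concavity says
    [delta (T x) <= delta x]; as [|T^n x|^2] is a concave nonnegative sequence,
    [0 <= delta].  An operator [S = (W, X; 0, T)] with [W^* X = 0] satisfies
    [|S k|^2 - |k|^2 = (|W w|^2 - |w|^2) + (|X h|^2 + delta h)] at
    [k = (w, h)], and it is a 2-isometry iff this form is [S]-invariant.

    (i) Let [W] be the block of two shifts, with [E0] and the first component
    of [X] orthogonal to each other and to the range of [S_+^1].  Then the
    components [X1 = Delta^(1/2) T] and [X0 = (Delta - T^* Delta T)^(1/2)] of
    [X] give the form [2 |w0|^2 + 2 delta h], which is invariant and has norm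
    [2 max(1, |Delta|)].

    (ii) With [W] a shift, one needs a [T]-invariant form [d] with
    [delta <= d <= c = |Delta|], and [X^* X = d - delta].  Put
    [Z = (c - Delta)^(1/2)] and [Q_0 = (c Delta)^(1/2)].  Since
    [|Q_0 x|^2 + |Z x|^2 <= |Z T x|^2], each [Q_j] factors through [Z T], and
    composing the factor with the projection onto the closure of [ran (Z T)]
    and with [Z] gives [Q_(j+1)] such that [Q_(j+1) T = Q_j] and
    [sum_(j >= 1) |Q_j x|^2 <= |Z x|^2].  Then
    [d x = c |x|^2 - sum_(j >= 1) |Q_j x|^2] is invariant.  Minimality is
    obtained by restricting the multiplicity space of the shift to the closed
    range of [X]. *)

(** * Limits of real sequences and quadratic inequalities *)

Section RealSequences.
Variable R : realType.
Implicit Types (a b : nat -> R) (l : R).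

Lemma cvgn_eps a l : (forall e, 0 < e -> exists N, forall n, (N <= n)%N ->
  `|a n - l| < e) -> a @ \oo --> l.
Proof.
move=> h; apply/cvgrPdist_lt => e e0; have [N hN] := h _ e0.
by exists N => // n /= /hN; rewrite distrC.
Qed.

Lemma eps_cvgn a l : a @ \oo --> l -> forall e, 0 < e ->
  exists N, forall n, (N <= n)%N -> `|a n - l| < e.
Proof.
move=> h e e0; move/cvgrPdist_lt: h => /(_ _ e0) [N _ hN].
by exists N => n /hN; rewrite /= distrC.
Qed.

Lemma cvgn_eq a l m : l = m -> a @ \oo --> l -> a @ \oo --> m.
Proof. by move=> ->. Qed.

Lemma squeeze0 a b : (forall n, 0 <= a n <= b n) -> b @ \oo --> (0 : R) ->
  a @ \oo --> (0 : R).
Proof.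
move=> h hb; apply: (squeeze_cvgr _ (cvg_cst _) hb).
by apply: nearW => n; exact: h.
Qed.

Lemma cvgn_le a b l m : a @ \oo --> l -> b @ \oo --> m ->
  (forall n, a n <= b n) -> l <= m.
Proof. by move=> ha hb h; apply: (ler_cvg_to ha hb); apply: nearW. Qed.

Lemma cvgn_uniq a l m : a @ \oo --> l -> a @ \oo --> m -> l = m.
Proof. by move=> ha hb; apply: (cvg_unique _ ha hb). Qed.

Lemma monotone_cvgn a M : (forall n, a n <= a n.+1) -> (forall n, a n <= M) ->
  exists l, [/\ a @ \oo --> l, forall n, a n <= l & l <= M].
Proof.
move=> h1 h2.
have hn : {homo a : n m / (n <= m)%N >-> n <= m}.
  by apply: homo_leq => //; exact: le_trans.
have hu : has_ubound (range a) by exists M => _ [n _ <-].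
have ha := nondecreasing_is_cvgn hn hu.
exists (limn a); split; first exact: ha.
- by move=> n; apply: nondecreasing_cvgn_le.
- by apply: (cvgn_le ha (cvg_cst M)).
Qed.

Lemma cauchy_cvgn a : (forall e, 0 < e -> exists N, forall m n,
  (N <= m)%N -> (N <= n)%N -> `|a m - a n| < e) -> exists l, a @ \oo --> l.
Proof.
move=> h; suff : cvgn a by move=> ha; exists (limn a).
apply: R_complete; apply: cauchy_exP => e e0.
have [N hN] := h _ e0; exists (a N), N => // n /= hn.
by rewrite /ball /=; apply: hN.
Qed.

Lemma le_of_sqr (x y : R) : 0 <= y -> x ^+ 2 <= y ^+ 2 -> x <= y.
Proof.
move=> y0 h; apply: (le_trans (ler_norm _)).
by rewrite -ler_sqr ?nnegrE// real_normK ?num_real.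
Qed.

Lemma lt_of_sqr (x y : R) : 0 < y -> x ^+ 2 < y ^+ 2 -> `|x| < y.
Proof.
move=> y0 h; rewrite -ltr_sqr ?nnegrE ?normr_ge0 ?ltW//.
by rewrite real_normK ?num_real.
Qed.

(** For [r > 0] the quadratic is evaluated at its minimiser [t = - q / r]. For [r = 0] it is affine
    in [t], and a nonzero slope would make it equal to [-1] at [t = - (p + 1) / (2 * q)]. *)
Lemma discr_le (p q r : R) : 0 <= r ->
  (forall t, 0 <= p + 2 * t * q + t ^+ 2 * r) -> q ^+ 2 <= p * r.
Proof.
rewrite le_eqVlt => /predU1P[<-|r0] h.
  have p0 : 0 <= p by have := h 0; rewrite !(mulr0, mul0r, addr0, expr0n).
  rewrite mulr0; have [->|q0] := eqVneq q 0; first by rewrite expr0n.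
  have := h (- (p + 1) / (2 * q)).
  have -> : p + 2 * (- (p + 1) / (2 * q)) * q +
    (- (p + 1) / (2 * q)) ^+ 2 * 0 = - 1 by field.
  by rewrite ler0N1.
have := h (- q / r).
have -> : p + 2 * (- q / r) * q + (- q / r) ^+ 2 * r = (p * r - q ^+ 2) / r.
  by field; rewrite gt_eqF.
by rewrite pmulr_lge0 ?invr_gt0// subr_ge0.
Qed.

End RealSequences.

(** * Real inner product, squared norm and convergence *)

Section RealInner.
Variable R : realType.

(** Most estimates use the real part and the squared norm: they are then polynomial over [R], within
    reach of [lra] and [nra], and [hinner_rip] recovers the complex inner product from [rip]. *)
Definition rip {K : hilbert R} (x y : K) : R := complex.Re (hinner x y).
Definition nsq {K : hilbert R} (x : K) : R := rip x x.

Variable K : hilbert R.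
Implicit Types (x y z : K) (t : R).

Lemma hinnerD x y z : hinner (x + y) z = hinner x z + hinner y z.
Proof. by rewrite -[x]scale1r hinnerDl mul1r scale1r. Qed.

Lemma hinner0l z : hinner 0 z = 0.
Proof. by apply: (addrI (hinner 0 z)); rewrite -hinnerD !addr0. Qed.

Lemma hinnerZ (a : R[i]) x z : hinner (a *: x) z = a * hinner x z.
Proof. by rewrite -[a *: x]addr0 hinnerDl hinner0l addr0. Qed.

Lemma hinnerZr (a : R[i]) x z : hinner x (a *: z) = conjc a * hinner x z.
Proof. by rewrite hinner_conj hinnerZ rmorphM /= -hinner_conj. Qed.

Lemma ripDl x y z : rip (x + y) z = rip x z + rip y z.
Proof. by rewrite /rip hinnerD; case: (hinner x z) => ? ?; case: hinner. Qed.

Lemma ripC x y : rip x y = rip y x.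
Proof. by rewrite /rip hinner_conj; case: hinner. Qed.

Lemma ripDr x y z : rip x (y + z) = rip x y + rip x z.
Proof. by rewrite ripC ripDl !(ripC x). Qed.

Lemma ripZl t x y : rip (t%:C *: x) y = t * rip x y.
Proof. by rewrite /rip hinnerZ; case: hinner => a b /=; rewrite mul0r subr0. Qed.

Lemma ripZr t x y : rip x (t%:C *: y) = t * rip x y.
Proof. by rewrite ripC ripZl ripC. Qed.

Lemma rip_il x y : rip ('i *: x) y = - rip x ('i *: y).
Proof.
rewrite /rip hinnerZ hinnerZr; case: hinner => a b /=.
by rewrite !mul0r !mul1r mulN1r sub0r opprK add0r.
Qed.

Lemma hinner_rip x y : hinner x y = Complex (rip x y) (rip x ('i *: y)).
Proof.
rewrite /rip hinnerZr; case: hinner => a b /=.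
by rewrite !mul0r mulN1r opprK add0r.
Qed.

Lemma ripNl x y : rip (- x) y = - rip x y.
Proof. by rewrite -[RHS]mulN1r -ripZl rmorphN1 scaleN1r. Qed.

Lemma ripNr x y : rip x (- y) = - rip x y.
Proof. by rewrite ripC ripNl ripC. Qed.

Lemma rip0l x : rip 0 x = 0.
Proof. by rewrite /rip hinner0l. Qed.

Lemma rip0r x : rip x 0 = 0.
Proof. by rewrite ripC rip0l. Qed.

Definition ripE := (ripDl, ripDr, ripNl, ripNr, ripZl, ripZr, rip0l, rip0r).

Lemma rip_eq0 x y : rip x y = 0 -> rip x ('i *: y) = 0 -> hinner x y = 0.
Proof. by rewrite hinner_rip => -> ->. Qed.

Lemma nsq_hinner x : hinner x x = (nsq x)%:C.
Proof.
have := hinner_ge0 x; rewrite /nsq /rip lecE; case: hinner => a b /=.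
by case/andP => /eqP -> _.
Qed.

Lemma nsq_ge0 x : 0 <= nsq x.
Proof. by have := hinner_ge0 x; rewrite nsq_hinner ler0c. Qed.
Hint Resolve nsq_ge0 : core.

Lemma nsq_eq0 x : nsq x = 0 -> x = 0.
Proof. by move=> h; apply: hinner_eq0; rewrite nsq_hinner h. Qed.

Lemma nsq0 : nsq (0 : K) = 0.
Proof. exact: rip0l. Qed.

Lemma nsq_le0 x : nsq x <= 0 -> x = 0.
Proof. by move=> h; apply: nsq_eq0; apply/eqP; rewrite eq_le h nsq_ge0. Qed.

Lemma nsqN x : nsq (- x) = nsq x.
Proof. by rewrite /nsq !ripE opprK. Qed.

Lemma nsqBC x y : nsq (x - y) = nsq (y - x).
Proof. by rewrite -nsqN opprB. Qed.

Lemma nsqZ (a : R[i]) x :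
  nsq (a *: x) = (complex.Re a ^+ 2 + complex.Im a ^+ 2) * nsq x.
Proof.
rewrite {1}/nsq /rip hinnerZ hinnerZr nsq_hinner; case: a => a b /=; ring.
Qed.

Lemma nsqZr t x : nsq (t%:C *: x) = t ^+ 2 * nsq x.
Proof. by rewrite nsqZ /= expr0n addr0. Qed.

Lemma nsqD x y : nsq (x + y) = nsq x + nsq y + 2 * rip x y.
Proof. by rewrite /nsq !ripE (ripC y x); ring. Qed.

Lemma nsqB x y : nsq (x - y) = nsq x + nsq y - 2 * rip x y.
Proof. by rewrite nsqD nsqN ripNr; ring. Qed.

Lemma nsqD_le x y : nsq (x + y) <= 2 * (nsq x + nsq y).
Proof. by have := nsq_ge0 (x - y); rewrite nsqB nsqD; lra. Qed.

Lemma cauchy_schwarz x y : rip x y ^+ 2 <= nsq x * nsq y.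
Proof.
apply: discr_le => // t; have := nsq_ge0 (x + t%:C *: y).
by rewrite nsqD nsqZr ripZr; lra.
Qed.

Lemma rip_ext x y : (forall z, rip x z = rip y z) -> x = y.
Proof.
move=> h; apply/eqP; rewrite -subr_eq0; apply/eqP/nsq_eq0.
by rewrite /nsq ripDl ripNl h subrr.
Qed.

Lemma hnormE x : hnorm x = Num.sqrt (nsq x).
Proof. by []. Qed.

Lemma hnorm_ge0 x : 0 <= hnorm x.
Proof. exact: sqrtr_ge0. Qed.

Lemma hnorm_sqr x : hnorm x ^+ 2 = nsq x.
Proof. by rewrite hnormE sqr_sqrtr. Qed.

Lemma hnorm_le t x : 0 <= t -> (hnorm x <= t) = (nsq x <= t ^+ 2).
Proof. by move=> t0; rewrite -hnorm_sqr ler_sqr// nnegrE hnorm_ge0. Qed.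

Lemma rip_le x y : rip x y <= hnorm x * hnorm y.
Proof.
apply: le_of_sqr; first by rewrite mulr_ge0 ?hnorm_ge0.
by rewrite exprMn !hnorm_sqr cauchy_schwarz.
Qed.

Lemma hnormD x y : hnorm (x + y) <= hnorm x + hnorm y.
Proof.
rewrite hnorm_le ?addr_ge0 ?hnorm_ge0// nsqD sqrrD !hnorm_sqr.
by have := rip_le x y; rewrite -mulr_natl; lra.
Qed.

Lemma hnorm0 : hnorm (0 : K) = 0.
Proof. by rewrite hnormE nsq0 sqrtr0. Qed.

Lemma hnormZr t x : 0 <= t -> hnorm (t%:C *: x) = t * hnorm x.
Proof.
by move=> t0; rewrite !hnormE nsqZr sqrtrM ?sqr_ge0// sqrtr_sqr ger0_norm.
Qed.

Lemma cvg_toE (u : nat -> K) l :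
  cvg_to u l <-> (fun n => nsq (u n - l)) @ \oo --> (0 : R).
Proof.
split=> [h|h e e0].
  apply: cvgn_eps => e e0.
  have [|N hN] := h (Num.sqrt e); first by rewrite sqrtr_gt0.
  exists N => n /hN; rewrite subr0 ger0_norm//.
  by rewrite /ip_norm -/(rip _ _) -/(nsq _) ltr_sqrt.
have [|N hN] := eps_cvgn h (e := e ^+ 2); first by rewrite exprn_gt0.
exists N => n /hN; rewrite subr0 ger0_norm// => hn.
rewrite -(ger0_norm (ltW e0)) -sqrtr_sqr /ip_norm -/(rip _ _) -/(nsq _).
by rewrite ltr_sqrt// exprn_gt0.
Qed.

Lemma nsq_cauchy (u : nat -> K) : (forall e, 0 < e -> exists N, forall m n,
  (N <= m)%N -> (N <= n)%N -> nsq (u m - u n) < e) -> exists l, cvg_to u l.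
Proof.
move=> h; apply: hcomplete => e e0.
have [|N hN] := h (e ^+ 2); first by rewrite exprn_gt0.
exists N => m n hm hn; rewrite /ip_norm -/(rip _ _) -/(nsq _).
rewrite -(ger0_norm (ltW e0)) -sqrtr_sqr ltr_sqrt ?exprn_gt0//; exact: hN.
Qed.

(** The Cauchy property is inherited from [a]. For the square root iteration, [a] is the scalar
    iteration times [hnorm x]. *)
Lemma nsq_cauchy_dom (u : nat -> K) (a : nat -> R) (l : R) : a @ \oo --> l ->
  (forall m n, (n <= m)%N -> hnorm (u m - u n) <= a m - a n) ->
  exists k, cvg_to u k.
Proof.
move=> ha h; apply: nsq_cauchy => e e0.
have [|N hN] := eps_cvgn ha (e := Num.sqrt e / 2).
  by rewrite divr_gt0 ?sqrtr_gt0.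
have key m n : (N <= n)%N -> (n <= m)%N -> nsq (u m - u n) < e.
  move=> hn hnm; rewrite -ltr_sqrt// -/(hnorm _).
  apply: (le_lt_trans (h _ _ hnm)).
  have := hN _ hn; have := hN _ (leq_trans hn hnm).
  by rewrite !ltr_norml => /andP[? ?] /andP[? ?]; lra.
exists N => m n hm hn; case: (leqP n m) => [|/ltnW] hnm; first exact: key.
by rewrite nsqBC key.
Qed.

Lemma cvg_to_uniq (u : nat -> K) l m : cvg_to u l -> cvg_to u m -> l = m.
Proof.
move=> /cvg_toE hl /cvg_toE hm.
apply/eqP; rewrite -subr_eq0; apply/eqP/nsq_le0.
have h0 : (fun n => 2 * (nsq (u n - l) + nsq (u n - m))) @ \oo
  --> (2 * (0 + 0) : R) by apply: cvgM; [exact: cvg_cst | exact: cvgD].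
rewrite -[X in _ <= X](_ : 2 * (0 + 0) = 0); last by ring.
apply: (cvgn_le (cvg_cst _) h0) => n.
rewrite -(nsqN (u n - l)); apply: le_trans (nsqD_le _ _).
by rewrite opprB addrA subrK.
Qed.

Lemma cvg_to_rip (u v : nat -> K) l m : cvg_to u l -> cvg_to v m ->
  (fun n => rip (u n) (v n)) @ \oo --> rip l m.
Proof.
move=> /cvg_toE hl /cvg_toE hm.
(* Cauchy-Schwarz: pairing a null sequence with a fixed vector gives a null sequence. Using
   [nsq y + 1] avoids a division by zero. *)
have key (w : nat -> K) (y : K) : (fun n => nsq (w n)) @ \oo --> (0 : R) ->
  (fun n => rip (w n) y) @ \oo --> (0 : R).
  move=> h; apply: cvgn_eps => e e0.
  have y0 : 0 < nsq y + 1 by rewrite ltr_wpDl.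
  have [|N hN] := eps_cvgn h (e := e ^+ 2 / (nsq y + 1)).
    by rewrite divr_gt0// exprn_gt0.
  exists N => n /hN; rewrite !subr0 ger0_norm// ltr_pdivlMr// => hn.
  apply: lt_of_sqr => //.
  by apply: le_lt_trans hn; apply: (le_trans (cauchy_schwarz _ _));
    rewrite ler_wpM2l// lerDl.
have h1 := key _ m hl; have h2 := key _ l hm.
have h3 : (fun n => nsq (u n - l + (v n - m))) @ \oo --> (0 : R).
  apply: (squeeze0 (b := fun n => 2 * (nsq (u n - l) + nsq (v n - m)))).
    by move=> n; rewrite nsq_ge0 nsqD_le.
  apply: (cvgn_eq (l := 2 * (0 + 0))); first by ring.
  by apply: cvgM; [exact: cvg_cst | exact: cvgD].
(* The mixed term [rip (u n - l) (v n - m)] is polarised, so that only squared norms of null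
   sequences remain. *)
have -> : (fun n => rip (u n) (v n)) = (fun n => rip l m + rip (u n - l) m +
  rip (v n - m) l + 2^-1 * (nsq (u n - l + (v n - m)) -
  nsq (u n - l) - nsq (v n - m))).
  by apply/funext => n; rewrite nsqD !ripE !(ripC m) (ripC (v n) l); field.
apply: (cvgn_eq (l := rip l m + 0 + 0 + 2^-1 * (0 - 0 - 0))); first by ring.
apply: cvgD; first by apply: cvgD => //; apply: cvgD => //; exact: cvg_cst.
apply: cvgM; first exact: cvg_cst.
by apply: cvgB => //; apply: cvgB.
Qed.

Lemma cvg_to_cst (x : K) : cvg_to (fun=> x) x.
Proof. by apply/cvg_toE; rewrite subrr nsq0; exact: cvg_cst. Qed.

Lemma cvg_to_nsq (u : nat -> K) l : cvg_to u l ->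
  (fun n => nsq (u n)) @ \oo --> nsq l.
Proof. by move=> h; exact: cvg_to_rip. Qed.

Lemma cvg_toD (u v : nat -> K) l m : cvg_to u l -> cvg_to v m ->
  cvg_to (fun n => u n + v n) (l + m).
Proof.
move=> /cvg_toE hl /cvg_toE hm; apply/cvg_toE.
apply: (squeeze0 (b := fun n => 2 * (nsq (u n - l) + nsq (v n - m)))).
  by move=> n; rewrite nsq_ge0 opprD addrACA nsqD_le.
apply: (cvgn_eq (l := 2 * (0 + 0))); first by ring.
by apply: cvgM; [exact: cvg_cst | exact: cvgD].
Qed.

Lemma cvg_toZ (a : R[i]) (u : nat -> K) l : cvg_to u l ->
  cvg_to (fun n => a *: u n) (a *: l).
Proof.
move=> /cvg_toE hl; apply/cvg_toE.
have -> : (fun n => nsq (a *: u n - a *: l)) =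
  (fun n => (complex.Re a ^+ 2 + complex.Im a ^+ 2) * nsq (u n - l)).
  by apply/funext => n; rewrite -scalerBr nsqZ.
apply: (cvgn_eq (mulr0 (complex.Re a ^+ 2 + complex.Im a ^+ 2))).
by apply: cvgM => //; exact: cvg_cst.
Qed.

Lemma cvg_toB (u v : nat -> K) l m : cvg_to u l -> cvg_to v m ->
  cvg_to (fun n => u n - v n) (l - m).
Proof.
move=> hu hv; rewrite -scaleN1r.
have -> : (fun n => u n - v n) = (fun n => u n + (-1) *: v n).
  by apply/funext => n; rewrite scaleN1r.
exact/cvg_toD/cvg_toZ.
Qed.

End RealInner.
#[export] Hint Extern 0 (is_true (@Order.le _ _ _ (nsq _))) =>
  solve [apply: nsq_ge0] : core.
#[export] Hint Extern 0 (is_true (@Order.le _ _ _ (hnorm _))) =>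
  solve [apply: hnorm_ge0] : core.

(** * Riesz representation, orthogonal projection and density *)

Section Riesz.
Variables (R : realType) (K : hilbert R).

(* The representing vector minimises [nsq x - 2 f x] over the closure of [L];
   [L := setT] is Riesz' theorem and [f := rip e] the orthogonal projection. *)
Lemma riesz_subspace (L : set K) (f : K -> R) (M : R) : 0 <= M ->
  L 0 -> (forall t x y, L x -> L y -> L (t%:C *: x + y)) ->
  (forall t x y, f (t%:C *: x + y) = t * f x + f y) ->
  (forall x, f x ^+ 2 <= M * nsq x) ->
  exists p (u : nat -> K), [/\ forall n, L (u n), cvg_to u p &
    forall x, L x -> rip p x = f x].
Proof.
move=> M0 L0 LD fD fM; pose phi x := nsq x - 2 * f x.
have f0 : f 0 = 0 by have := fD (-1) 0 0; rewrite scaler0 addr0; lra.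
have fZ t x : f (t%:C *: x) = t * f x by rewrite -[_ *: x]addr0 fD f0 addr0.
have LZ t x : L x -> L (t%:C *: x).
  by move=> Lx; rewrite -[_ *: x]addr0; exact: LD.
have philb x : - M <= phi x.
  suff : 2 * f x <= M + nsq x by rewrite /phi; lra.
  apply: le_of_sqr; first by apply: addr_ge0.
  by have := fM x; have := sqr_ge0 (M - nsq x); nra.
pose E := [set phi x | x in L].
have hE : has_inf E.
  by split; [exists (phi 0), 0 | exists (- M) => _ [x _ <-]; exact: philb].
pose m := inf E.
have hm x : L x -> m <= phi x.
  by move=> Lx; apply: ge_inf => //; [exact: hE.2 | exists x].
have /choice[u hu] n : exists x, L x /\ phi x < m + n.+1%:R^-1.
  have [|_ [x Lx <-] hx] := inf_adherent (eps := n.+1%:R^-1) _ hE.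
    by rewrite invr_gt0.
  by exists x.
(* Parallelogram law: the midpoint of two near-minimisers is again in [L], so [phi] is at least [m]
   there, which forces the two points together. *)
have hum x y a b : L x -> L y -> phi x < m + a -> phi y < m + b ->
    nsq (x - y) < 2 * (a + b).
  move=> Lx Ly hx hy.
  have := hm (2^-1%:C *: (x + y)) (LZ _ _ _).
  rewrite /phi nsqZr fZ -{1 2}[x](scale1r) => /(_ _).
  have Lxy : L (x + y) by rewrite -[x]scale1r; apply: (LD 1).
  have fxy : f (x + y) = f x + f y.
    by rewrite -[x in LHS]scale1r (fD 1) mul1r.
  rewrite scale1r fxy => /(_ Lxy); move: hx hy; rewrite /phi.
  by rewrite nsqB nsqD; lra.
have [p hp] : exists p, cvg_to u p.
  apply: nsq_cauchy => e e0.
  have [|N hN] := eps_cvgn (@cvg_harmonic R) (e := e / 4).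
    by rewrite divr_gt0.
  have hb k : (N <= k)%N -> k.+1%:R^-1 < e / 4.
    by move=> /hN; rewrite /harmonic subr0 ger0_norm ?invr_ge0.
  exists N => i j /hb hi /hb hj.
  apply: (lt_le_trans (hum _ _ _ _ (hu i).1 (hu j).1 (hu i).2 (hu j).2)).
  by move: (i.+1%:R^-1) (j.+1%:R^-1) hi hj => p q; lra.
exists p, u; split=> // [n|x Lx]; first exact: (hu n).1.
have h1 := cvg_to_rip hp (cvg_to_cst x).
apply: (cvgn_uniq h1); apply: cvgn_eps => e e0.
have x0 : 0 < nsq x + 1 by rewrite ltr_wpDl.
have [|N hN] := eps_cvgn (@cvg_harmonic R) (e := e ^+ 2 / (nsq x + 1)).
  by rewrite divr_gt0// exprn_gt0.
exists N => n /hN; rewrite /harmonic subr0 ger0_norm ?invr_ge0// => hn.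
apply: lt_of_sqr => //.
(* First-order condition in quantitative form: [phi] at [t x + u n] is at least [m] for all [t], and
   the discriminant bounds the coefficient of [t]. *)
have h2 : (rip (u n) x - f x) ^+ 2 <= n.+1%:R^-1 * nsq x.
  apply: discr_le => // t.
  have := hm _ (LD t _ _ Lx (hu n).1); move: (n.+1%:R^-1) (hu n).2 => c.
  by rewrite /phi nsqD fD nsqZr ripZl (ripC x); lra.
apply: (le_lt_trans h2); rewrite ltr_pdivlMr// in hn.
by apply: le_lt_trans hn; rewrite ler_wpM2l ?invr_ge0// lerDl.
Qed.

(** The sequence [u] records that [p] lies in the closure of [L], onto which it is the orthogonal
    projection of [e]. *)
Lemma projection_subspace (L : set K) (e : K) : L 0 ->
  (forall (a : R[i]) x y, L x -> L y -> L (a *: x + y)) ->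
  exists p (u : nat -> K), [/\ forall n, L (u n), cvg_to u p &
    forall x, L x -> rip (e - p) x = 0].
Proof.
move=> L0 LD.
have [||p [u [Lu up hp]]] := @riesz_subspace L (fun x => rip e x) (nsq e) _ L0
    (fun t => LD t%:C) _ (fun x => cauchy_schwarz e x); first exact: nsq_ge0.
  by move=> t x y; rewrite !ripE.
by exists p, u; split => // x Lx; rewrite !ripE hp// subrr.
Qed.

(** Subtracting from [k] its projection onto the closed span of [A] leaves a vector orthogonal to
    [A], hence zero. *)
Lemma dense_of_orth (A : set K) :
  (forall x, (forall a, A a -> hinner x a = 0) -> x = 0) ->
  forall k, cspan A k.
Proof.
move=> hA k; have [||p [u [Lu up hp]]] := @projection_subspace (span_of A) k.
- by exists [::]; rewrite big_nil.
- move=> a _ _ [s [hs ->]] [s' [hs' ->]].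
  exists ([seq (a * q.1, q.2) | q <- s] ++ s'); split.
    move=> q; rewrite mem_cat => /orP[/mapP[q' /hs ? ->]|/hs'] //.
  rewrite big_cat big_map scaler_sumr; congr (_ + _).
  by apply: eq_bigr => q _; rewrite scalerA.
- have Aa (c : R[i]) a : A a -> span_of A (c *: a).
    by move=> ha; exists [:: (c, a)]; split;
      [move=> q; rewrite inE => /eqP -> | rewrite big_seq1].
  have kp : k = p.
    apply/eqP; rewrite -subr_eq0; apply/eqP/hA => a ha.
    by apply: rip_eq0; rewrite ?hp//; [rewrite -[a]scale1r|]; exact: Aa.
  by exists u; rewrite kp.
Qed.

End Riesz.

(** * Bounded operators, adjoints and operator norms *)

Section Operators.
Variable R : realType.
Implicit Types K : hilbert R.

Definition linear_op {K1 K2 : hilbert R} (A : K1 -> K2) : Prop :=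
  forall (a : R[i]) (x y : K1), A (a *: x + y) = a *: A x + A y.

Section Linear.
Variables (K1 K2 : hilbert R) (A : K1 -> K2).
Hypothesis linA : linear_op A.

Lemma linear_op0 : A 0 = 0.
Proof. by have := linA (-1) 0 0; rewrite !scaleN1r !oppr0 addr0 addNr. Qed.

Lemma linear_opZ a x : A (a *: x) = a *: A x.
Proof. by rewrite -[a *: x]addr0 linA linear_op0 addr0. Qed.

Lemma linear_opD x y : A (x + y) = A x + A y.
Proof. by rewrite -{1}[x]scale1r linA scale1r. Qed.

Lemma linear_opB x y : A (x - y) = A x - A y.
Proof. by rewrite linear_opD -scaleN1r linear_opZ scaleN1r. Qed.

Lemma bounded_of_nsq M : (forall x, nsq (A x) <= M * nsq x) -> bounded_op A.
Proof.
move=> h; split=> //; exists (Num.sqrt `|M|) => x.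
rewrite !hnormE -sqrtrM ?normr_ge0// ler_wsqrtr//.
by apply: (le_trans (h x)); rewrite ler_wpM2r// ler_norm.
Qed.
End Linear.

Lemma bounded_nsq K1 K2 (A : K1 -> K2) : bounded_op A ->
  exists2 M, 0 <= M & forall x, nsq (A x) <= M * nsq x.
Proof.
move=> [_ [M hM]]; exists (M ^+ 2); first exact: sqr_ge0.
move=> x; rewrite -!hnorm_sqr -exprMn ler_sqr ?nnegrE//.
by apply: le_trans (hM x); exact: hnorm_ge0.
Qed.

Lemma bounded_lin K1 K2 (A : K1 -> K2) : bounded_op A -> linear_op A.
Proof. by case. Qed.

Lemma bounded_comp K1 K2 K3 (A : K2 -> K3) (B : K1 -> K2) :
  bounded_op A -> bounded_op B -> bounded_op (fun x => A (B x)).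
Proof.
move=> bA bB; have [M M0 hM] := bounded_nsq bA; have [N N0 hN] := bounded_nsq bB.
apply: (bounded_of_nsq _ (M := M * N)) => [a x y|x].
  by rewrite (bounded_lin bB) (bounded_lin bA).
by apply: (le_trans (hM _)); rewrite -mulrA ler_wpM2l.
Qed.

(** The imaginary part of [hinner (A x) y] is [- rip (A ('i *: x)) y], by linearity, so the real
    identity at ['i *: x] settles it. *)
Lemma is_adjoint_rip K1 K2 (A : K1 -> K2) (B : K2 -> K1) : linear_op A ->
  (forall x y, rip (A x) y = rip x (B y)) -> is_adjoint A B.
Proof.
move=> linA h x y; rewrite !hinner_rip h; congr Complex.
apply: oppr_inj; rewrite -!rip_il -h.
by rewrite linear_opZ.
Qed.

(** Since [adj] is an [epsilon], its defining property holds once some adjoint exists; Riesz'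
    theorem applied to [x |-> rip (A x) y] supplies its value at [y]. *)
Lemma adj_exists K1 K2 (A : K1 -> K2) : bounded_op A ->
  exists B, is_adjoint A B.
Proof.
move=> bA; have [M M0 hM] := bounded_nsq bA; have linA := bounded_lin bA.
suff /choice[B hB] : forall y, exists z, forall x, rip (A x) y = rip x z.
  by exists B; apply: is_adjoint_rip => // x y; exact: hB.
move=> y; have [|||p [u [_ _ hp]]] := @riesz_subspace R K1 setT
    (fun x => rip (A x) y) (M * nsq y) _ I (fun _ _ _ _ _ => I).
- by rewrite mulr_ge0.
- by move=> t x z; rewrite linA !ripE.
- move=> x; apply: (le_trans (cauchy_schwarz _ _)).
  by rewrite mulrAC ler_wpM2r.
- by exists p => x; rewrite ripC [RHS]ripC hp// ripC.
Qed.

Lemma adjP K1 K2 (A : K1 -> K2) : bounded_op A ->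
  forall x y, hinner (A x) y = hinner x (adj A y).
Proof. by move=> /adj_exists h; exact: (epsilon_spec _ (is_adjoint A) h). Qed.

Lemma adj_rip K1 K2 (A : K1 -> K2) : bounded_op A ->
  forall x y, rip (A x) y = rip x (adj A y).
Proof. by move=> bA x y; rewrite /rip adjP. Qed.

Lemma adj_uniq K1 K2 (A : K1 -> K2) (B : K2 -> K1) : is_adjoint A B ->
  forall y, adj A y = B y.
Proof.
move=> h y; apply: rip_ext => z; rewrite ripC [RHS]ripC /rip -h.
have h1 := epsilon_spec (inhabits (fun=> 0)) (is_adjoint A) (ex_intro _ B h).
by rewrite (h1 z y).
Qed.

Lemma adj_lin K1 K2 (A : K1 -> K2) : bounded_op A -> linear_op (adj A).
Proof.
move=> bA a x y; apply: rip_ext => z; rewrite ![rip _ z]ripC.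
rewrite -(adj_rip bA) ripDr ripDr -(adj_rip bA z y); congr (_ + _).
by rewrite /rip !hinnerZr (adjP bA).
Qed.

Lemma adj_bounded K1 K2 (A : K1 -> K2) : bounded_op A -> bounded_op (adj A).
Proof.
move=> bA; have [M M0 hM] := bounded_nsq bA.
apply: (bounded_of_nsq (adj_lin bA) (M := M)) => y.
have h : nsq (adj A y) ^+ 2 <= M * nsq (adj A y) * nsq y.
  rewrite {1}/nsq -(adj_rip bA); apply: (le_trans (cauchy_schwarz _ _)).
  by rewrite ler_wpM2r.
have [->|y0] := eqVneq (nsq (adj A y)) 0; first by rewrite mulr_ge0.
move: h; rewrite expr2 mulrAC [X in _ <= X]mulrC ler_pM2l//.
by rewrite lt_def y0 nsq_ge0.
Qed.

(** Expanding the form at [x + A x] leaves [2 * nsq (A x)]. This reduces operator identities to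
    identities between squared norms. *)
Lemma symmetric_op_eq0 K (A : K -> K) : linear_op A ->
  (forall x y, rip (A x) y = rip x (A y)) -> (forall x, rip (A x) x = 0) ->
  forall x, A x = 0.
Proof.
move=> linA symA h x; apply: nsq_eq0; have := h (x + A x).
by rewrite (linear_opD linA) !ripE (symA (A x) x) !h /nsq; lra.
Qed.

Lemma rip_second_diff K (S : K -> K) : bounded_op S -> forall x y,
  rip (second_diff S x) y = rip (S (S x)) (S (S y)) - 2 * rip (S x) (S y) +
    rip x y.
Proof.
move=> bS x y; rewrite /second_diff mulr2n !ripE !(ripC (adj _ _)).
by rewrite -!(adj_rip bS) !(ripC _ (S (S x))) (ripC (S y)); ring.
Qed.

Lemma nsq_second_diff K (S : K -> K) : bounded_op S -> forall x,
  rip (second_diff S x) x = nsq (S (S x)) - 2 * nsq (S x) + nsq x.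
Proof. by move=> bS x; rewrite rip_second_diff. Qed.

Lemma rip_Delta K (S : K -> K) : bounded_op S -> forall x y,
  rip (Delta S x) y = rip (S x) (S y) - rip x y.
Proof.
by move=> bS x y; rewrite /Delta !ripE (ripC (adj _ _)) -adj_rip// (ripC (S y)).
Qed.

Lemma Delta_lin K (S : K -> K) : bounded_op S -> linear_op (Delta S).
Proof.
move=> bS a x y; rewrite /Delta (bounded_lin bS) (adj_lin bS).
by rewrite scalerBr opprD addrACA.
Qed.

(** The operator [second_diff S] is symmetric, so it vanishes as soon as its quadratic form does. *)
Lemma two_isometry_nsq K (S : K -> K) : bounded_op S ->
  (forall x, nsq (S (S x)) - 2 * nsq (S x) + nsq x = 0) -> two_isometry S.
Proof.
move=> bS h; apply: symmetric_op_eq0 => [a x y|x y|x].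
- rewrite /second_diff !(bounded_lin bS) !(adj_lin bS) !mulr2n.
  by rewrite scalerDr scalerBr scalerDr (addrACA (a *: adj S (S x))) opprD
    (addrACA (a *: adj S (adj S (S (S x))))) [LHS]addrACA.
- by rewrite [RHS]ripC !rip_second_diff// (ripC (S (S y))) (ripC (S y)) (ripC y).
- by rewrite nsq_second_diff.
Qed.

Lemma isometry_nsq K1 K2 (V : K1 -> K2) : linear_op V ->
  (forall x, nsq (V x) = nsq x) -> bounded_op V /\ is_isometry V.
Proof.
move=> linV h.
have bV : bounded_op V.
  by apply: (bounded_of_nsq linV (M := 1)) => x; rewrite h mul1r.
split=> // x; apply: subr0_eq; move: x.
have e x y : rip (adj V (V x) - x) y = rip (V x) (V y) - rip x y.
  by rewrite !ripE (ripC (adj _ _)) -adj_rip// (ripC (V y)).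
apply: symmetric_op_eq0 => [a x y|x y|x].
- by rewrite linV (adj_lin bV) scalerBr opprD addrACA.
- by rewrite e [RHS]ripC e (ripC (V y)) (ripC y).
- by rewrite e -/(nsq _) h subrr.
Qed.

Lemma concave_nsq K (T : K -> K) : bounded_op T -> concave_op T ->
  forall x, nsq (T (T x)) - 2 * nsq (T x) + nsq x <= 0.
Proof.
move=> bT cT x; rewrite -(nsq_second_diff bT) -oppr_ge0 -ripNl -[- _]add0r.
by have := cT x; rewrite /rip lecE => /andP[].
Qed.

(* The sequence [nsq (T^n x)] is concave and nonnegative, so it increases. *)
Lemma concave_expansive K (T : K -> K) : bounded_op T -> concave_op T ->
  forall x, nsq x <= nsq (T x).
Proof.
move=> bT cT x; rewrite leNgt; apply/negP => lt.
pose d := nsq x - nsq (T x).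
have d0 : 0 < d by rewrite subr_gt0.
have step n : nsq (iter n.+1 T x) <= nsq (iter n T x) - d.
  elim: n => [|n IH]; first by rewrite /d /=; lra.
  by have := concave_nsq bT cT (iter n T x); move: IH; rewrite /=; lra.
have h n : nsq (iter n T x) <= nsq x - n%:R * d.
  elim: n => [|n IH]; first by rewrite mul0r subr0.
  by apply: (le_trans (step n)); move: IH; rewrite -[n.+1]addn1 natrD; lra.
have [n hn] : exists n : nat, nsq x / d < n%:R.
  by exists (Num.bound (nsq x / d)); rewrite archi_boundP// divr_ge0// ltW.
have := h n; have := nsq_ge0 (iter n T x); rewrite ltr_pdivrMr// in hn.
by lra.
Qed.

Lemma opnorm_le K1 K2 (A : K1 -> K2) M : 0 <= M ->
  (forall x, hnorm (A x) <= M * hnorm x) -> opnorm A <= M.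
Proof.
move=> M0 h; apply: ge_sup; first by exists (hnorm (A 0)), 0; rewrite hnorm0.
move=> _ [x [x1 ->]]; apply: (le_trans (h x)).
by rewrite -[X in _ <= X]mulr1 ler_wpM2l.
Qed.

Lemma le_opnorm K1 K2 (A : K1 -> K2) : bounded_op A -> forall x,
  hnorm (A x) <= opnorm A * hnorm x.
Proof.
move=> bA x; have linA := bounded_lin bA.
have [x0|x0] := eqVneq (hnorm x) 0.
  have -> : x = 0 by apply: nsq_eq0; rewrite -hnorm_sqr x0 expr0n.
  by rewrite (linear_op0 linA) !hnorm0 mulr0.
have xp : 0 < hnorm x by rewrite lt_def x0 /=.
have h : hnorm (A ((hnorm x)^-1%:C *: x)) <= opnorm A.
  apply: ub_le_sup; last first.
    exists ((hnorm x)^-1%:C *: x); split=> //.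
    by rewrite hnormZr ?invr_ge0// mulVf.
  case: bA => _ [M hM]; exists `|M| => _ [y [y1 ->]].
  apply: (le_trans (hM y)); rewrite -[X in _ <= X]mulr1.
  apply: (le_trans (ler_norm _)); rewrite normrM ler_wpM2l//.
  by rewrite ger0_norm.
move: h; rewrite (linear_opZ linA) hnormZr ?invr_ge0//.
by rewrite mulrC ler_pdivrMr.
Qed.

Lemma opnorm_ge0 K1 K2 (A : K1 -> K2) : bounded_op A -> 0 <= opnorm A.
Proof.
move=> bA; apply: ub_le_sup; last first.
  by exists 0; rewrite (linear_op0 (bounded_lin bA)) !hnorm0.
case: bA => _ [M hM]; exists `|M| => _ [y [y1 ->]].
apply: (le_trans (hM y)); rewrite -[X in _ <= X]mulr1.
apply: (le_trans (ler_norm _)); rewrite normrM ler_wpM2l//.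
by rewrite ger0_norm.
Qed.

Lemma Delta_bounded K (S : K -> K) : bounded_op S -> bounded_op (Delta S).
Proof.
move=> bS.
have [M M0 hM] := bounded_nsq (bounded_comp (adj_bounded bS) bS).
apply: (bounded_of_nsq (Delta_lin bS) (M := 2 * (M + 1))) => x.
apply: (le_trans (nsqD_le _ _)); rewrite nsqN -mulrA ler_pM2l//.
by rewrite mulrDl mul1r lerD2r.
Qed.

Lemma opnorm_Delta_ub K (S : K -> K) : bounded_op S -> forall x,
  nsq (S x) - nsq x <= opnorm (Delta S) * nsq x.
Proof.
move=> bS x; rewrite /nsq -rip_Delta// -/(nsq _).
apply: (le_trans (rip_le _ _)); rewrite -hnorm_sqr expr2 mulrA ler_wpM2r//.
exact/le_opnorm/Delta_bounded.
Qed.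

(* Cauchy-Schwarz for the positive form [rip (A x) y], at [y = A x]. *)
Lemma symmetric_op_nsq K (A : K -> K) M : 0 <= M -> linear_op A ->
  (forall x y, rip (A x) y = rip x (A y)) ->
  (forall x, 0 <= rip (A x) x <= M * nsq x) ->
  forall x, nsq (A x) <= M ^+ 2 * nsq x.
Proof.
move=> M0 linA symA h x.
have h1 : nsq (A x) ^+ 2 <= (M * nsq x) * (M * nsq (A x)).
  have /andP[p0 p1] := h x; have /andP[q0 q1] := h (A x).
  apply: (@le_trans _ _ (rip (A x) x * rip (A (A x)) (A x))); last first.
    by apply: ler_pM.
  apply: discr_le => // t; have /andP[+ _] := h (x + t%:C *: A x).
  rewrite (linear_opD linA) (linear_opZ linA) !ripE (symA (A x) x) -/(nsq _).
  by lra.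
have [->|y0] := eqVneq (nsq (A x)) 0; first by rewrite mulr_ge0// sqr_ge0.
have yp : 0 < nsq (A x) by rewrite lt_def y0 nsq_ge0.
by rewrite -(ler_pM2r yp); move: h1; nra.
Qed.

(** For a positive [Delta S], a bound on the form is a bound on the operator, by [symmetric_op_nsq].
    Together with [opnorm_Delta_ub], this makes the covariance computable from
    [nsq (S x) - nsq x]. *)
Lemma opnorm_Delta_le K (S : K -> K) M : bounded_op S -> 0 <= M ->
  (forall x, 0 <= nsq (S x) - nsq x <= M * nsq x) -> opnorm (Delta S) <= M.
Proof.
move=> bS M0 h; apply: opnorm_le => // x.
apply: le_of_sqr; first by rewrite mulr_ge0.
rewrite exprMn !hnorm_sqr; apply: symmetric_op_nsq => //.
- exact: Delta_lin.
- by move=> y z; rewrite [RHS]ripC !rip_Delta// (ripC (S y)) (ripC y).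
- by move=> y; rewrite rip_Delta//; exact: h.
Qed.

End Operators.

(** * Square roots of positive operators *)

Section SquareRoot.
Variables (R : realType) (K : hilbert R).

Section Contraction.
Variable B : K -> K.
Hypothesis linB : linear_op B.
Hypothesis symB : forall x y, rip (B x) y = rip x (B y).
Hypothesis B1 : forall x, hnorm (B x) <= hnorm x.

(* [1 - Y] is the square root of [1 - B] when [Y = (B + Y^2) / 2]; the scalar
   iteration [t] with [B = 1] dominates the operator iteration. *)
Fixpoint sqrt_iter n : K -> K := if n is m.+1 then
  fun x => (2^-1)%:C *: (B x + sqrt_iter m (sqrt_iter m x)) else fun=> 0.

Fixpoint sqrt_scal n : R := if n is m.+1 then 2^-1 * (1 + sqrt_scal m ^+ 2)
  else 0.

Let Y := sqrt_iter.
Let t := sqrt_scal.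

Lemma sqrt_scal_bounds n : 0 <= t n <= t n.+1 /\ t n <= 1.
Proof.
elim: n => [|n [/andP[h0 h1] h2]]; first by rewrite /t /= expr2 mul0r; split; lra.
by move: h0 h1 h2; rewrite /t /= -/(t n) => h0 h1 h2; split; nra.
Qed.

Lemma sqrt_iter_lin n : linear_op (Y n).
Proof.
elim: n => [|n IH] a x y /=; first by rewrite scaler0 addr0.
by rewrite linB !IH addrACA -scalerDr (scalerDr (2^-1)%:C) !scalerA (mulrC a).
Qed.

Lemma sqrt_iter_sym n x y : rip (Y n x) y = rip x (Y n y).
Proof.
elim: n x y => [|n IH] x y /=; first by rewrite rip0l rip0r.
by rewrite ripZl ripZr ripDl ripDr symB !IH.
Qed.

Lemma sqrt_iter_norm n x : hnorm (Y n x) <= t n * hnorm x.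
Proof.
elim: n x => [|n IH] x /=; first by rewrite hnorm0 mul0r.
rewrite hnormZr ?invr_ge0// -mulrA ler_pM2l ?invr_gt0// mulrDl mul1r.
apply: (le_trans (hnormD _ _)); apply: lerD => //.
apply: (le_trans (IH _)); rewrite expr2 -mulrA ler_wpM2l//.
by have [/andP[]] := sqrt_scal_bounds n.
Qed.

Lemma sqrt_iter_step n x :
  hnorm (Y n.+1 x - Y n x) <= (t n.+1 - t n) * hnorm x.
Proof.
elim: n x => [|n IH] x.
  by rewrite /Y /t /= !subr0; exact: (sqrt_iter_norm 1).
(* The difference of squares is split as [a a - b b = a (a - b) + (a - b) b] with [a = Y n.+1] and
   [b = Y n]; the scalar identity below has the same shape, so the bounds match term by term. *)
have -> : Y n.+2 x - Y n.+1 x = (2^-1)%:C *: (Y n.+1 (Y n.+1 x - Y n x) +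
    (Y n.+1 (Y n x) - Y n (Y n x))).
  rewrite (linear_opB (@sqrt_iter_lin n.+1)) addrA subrK.
  rewrite {1}/Y /= -/(Y n) -/(Y n.+1) [in X in _ - X]/Y /= -scalerBr.
  by rewrite -/(Y n) -/(Y n.+1) opprD addrACA subrr add0r.
have -> : t n.+2 - t n.+1 = 2^-1 * ((t n.+1 - t n) * (t n.+1 + t n)).
  by rewrite /t /= -/(t n); field.
rewrite hnormZr ?invr_ge0// -[X in _ <= X]mulrA ler_pM2l ?invr_gt0//.
apply: (le_trans (hnormD _ _)); rewrite mulrDr mulrDl; apply: lerD.
  apply: (le_trans (sqrt_iter_norm _ _)); rewrite mulrC [X in _ <= X]mulrAC.
  rewrite ler_wpM2r// ; first by have [/andP[]] := sqrt_scal_bounds n.+1.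
apply: (le_trans (IH _)); rewrite -[X in _ <= X]mulrA ler_wpM2l ?sqrt_iter_norm//.
by have [/andP[]] := sqrt_scal_bounds n; rewrite subr_ge0.
Qed.

Lemma sqrt_iter_cvg x : exists l, cvg_to (fun n => Y n x) l.
Proof.
have [||l [hl _ _]] := @monotone_cvgn R t 1.
- by move=> n; have [/andP[]] := sqrt_scal_bounds n.
- by move=> n; have [] := sqrt_scal_bounds n.
apply: (nsq_cauchy_dom (a := fun n => t n * hnorm x) (l := l * hnorm x)).
  by apply: cvgM => //; exact: cvg_cst.
move=> m n /subnK <-; elim: (m - n)%N => [|k IH].
  by rewrite !subrr hnorm0.
rewrite addSn -(subrK (Y (k + n) x) (Y _ x)) -addrA.
apply: (le_trans (hnormD _ _)).
by have := sqrt_iter_step (k + n) x; move: IH; lra.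
Qed.

(** The limit [Z] of the iteration satisfies [2 Z = B + Z^2], so [1 - Z] squares to [1 - B]. *)
Lemma sqrt_complement : exists X : K -> K, [/\ linear_op X,
  (forall x y, rip (X x) y = rip x (X y)) & forall x, X (X x) = x - B x].
Proof.
have /boolp.choice[Z hZ] := sqrt_iter_cvg.
have symZ x y : rip (Z x) y = rip x (Z y).
  have h1 := cvg_to_rip (hZ x) (cvg_to_cst y).
  have h2 := cvg_to_rip (cvg_to_cst x) (hZ y).
  apply: (cvgn_uniq h1).
  by under eq_fun do rewrite sqrt_iter_sym.
have linZ : linear_op Z.
  move=> a x y; apply: (cvg_to_uniq (hZ _)).
  have -> : (fun n => Y n (a *: x + y)) = (fun n => a *: Y n x + Y n y).
    by apply/funext => n; rewrite sqrt_iter_lin.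
  exact/cvg_toD/hZ/cvg_toZ/hZ.
have ZZ x : 2%:C *: Z x = B x + Z (Z x).
  have h1 : cvg_to (fun n => 2%:C *: Y n.+1 x) (2%:C *: Z x).
    apply: cvg_toZ; apply/cvg_toE; have /cvg_toE := hZ x.
    by rewrite -(cvg_shiftS (fun n => nsq (Y n x - Z x))).
  apply: (cvg_to_uniq h1).
  (* Inside [Y n (Y n x)] the limit [Z x] is inserted; the error [Y n (Y n x - Z x)] tends to 0
     because every [Y n] is a contraction. *)
  have -> : (fun n => 2%:C *: Y n.+1 x) =
      (fun n => B x + (Y n (Z x) + Y n (Y n x - Z x))).
    apply/funext => n; rewrite (linear_opB (@sqrt_iter_lin n)) addrC [X in X + _]addrC.
    rewrite subrK /Y /= scalerA -rmorphM /= divff ?pnatr_eq0//.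
    by rewrite scale1r addrC.
  apply: cvg_toD (cvg_to_cst _) _; rewrite -[Z (Z x)]addr0.
  apply: cvg_toD => //; apply/cvg_toE.
  have /cvg_toE := hZ x; apply: squeeze0 => n; rewrite nsq_ge0 subr0 /=.
  rewrite -!hnorm_sqr ler_sqr ?nnegrE//.
  apply: (le_trans (sqrt_iter_norm _ _)); rewrite -[X in _ <= X]mul1r.
  by rewrite ler_wpM2r//; have [] := sqrt_scal_bounds n.
exists (fun x => x - Z x); split=> [a x y|x y|x].
- by rewrite linZ scalerBr opprD addrACA.
- by rewrite !ripE symZ.
- have e : Z x + Z x = B x + Z (Z x).
    by rewrite -ZZ rmorphD /= scalerDl scale1r.
  by rewrite (linear_opB linZ) -addrA -opprD addrA e addrK.
Qed.

End Contraction.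

(** Forms of bounded self-adjoint operators. Their closure under real combinations lets [psd_factor]
    apply to expressions in squared norms without an explicit operator. *)
Definition herm_form (q : K -> R) : Prop := exists A : K -> K,
  [/\ bounded_op A, forall x y, rip (A x) y = rip x (A y) &
      forall x, q x = rip (A x) x].

Lemma herm_form_nsq (K2 : hilbert R) (G : K -> K2) : bounded_op G ->
  herm_form (fun x => nsq (G x)).
Proof.
move=> bG; exists (fun x => adj G (G x)); split.
- exact: bounded_comp (adj_bounded bG) bG.
- by move=> x y; rewrite ripC -!adj_rip// ripC.
- by move=> x; rewrite ripC -adj_rip.
Qed.

Lemma herm_form_id : herm_form (fun x => nsq x).
Proof.
exists id; split=> //; apply: (bounded_of_nsq _ (M := 1)) => // x.
by rewrite mul1r.
Qed.

Lemma herm_formD p q : herm_form p -> herm_form q ->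
  herm_form (fun x => p x + q x).
Proof.
move=> [A [bA sA hA]] [B [bB sB hB]]; exists (fun x => A x + B x); split.
- have [M M0 hM] := bounded_nsq bA; have [N N0 hN] := bounded_nsq bB.
  apply: (bounded_of_nsq _ (M := 2 * (M + N))) => [a x y|x].
    by rewrite (bounded_lin bA) (bounded_lin bB) scalerDr addrACA.
  apply: (le_trans (nsqD_le _ _)); rewrite -mulrA ler_pM2l// mulrDl.
  exact: lerD.
- by move=> x y; rewrite !ripE sA sB.
- by move=> x; rewrite ripDl hA hB.
Qed.

Lemma herm_formZ (a : R) p : herm_form p -> herm_form (fun x => a * p x).
Proof.
move=> [A [bA sA hA]]; exists (fun x => a%:C *: A x); split.
- have [M M0 hM] := bounded_nsq bA.
  apply: (bounded_of_nsq _ (M := a ^+ 2 * M)) => [b x y|x].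
    by rewrite (bounded_lin bA) scalerDr !scalerA mulrC.
  by rewrite nsqZr -mulrA ler_wpM2l ?sqr_ge0.
- by move=> x y; rewrite !ripE sA.
- by move=> x; rewrite ripZl hA.
Qed.

(** If [0 <= q x <= M * nsq x], then [B = 1 - A / M] is a contraction, and [X] is [sqrt M] times the
    root of [1 - B = A / M]. *)
Lemma psd_factor q : herm_form q -> (forall x, 0 <= q x) ->
  exists2 X : K -> K, bounded_op X & forall x, nsq (X x) = q x.
Proof.
move=> [A [bA sA hA]] q0; have [N N0 hN] := bounded_nsq bA.
have linA := bounded_lin bA.
(* This [M] is positive and satisfies [N <= M ^+ 2], so it bounds the norm of [A]. *)
pose M := N + 1; have M0 : 0 < M by rewrite ltr_wpDl.
have qM x : q x <= M * nsq x.
  rewrite hA; apply: (le_trans (rip_le _ _)).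
  rewrite -hnorm_sqr expr2 mulrA ler_wpM2r//; apply: le_of_sqr.
    by rewrite mulr_ge0// ltW.
  rewrite exprMn !hnorm_sqr; apply: (le_trans (hN x)); rewrite ler_wpM2r//.
  by rewrite /M; nra.
pose B x := x - (M^-1)%:C *: A x.
have linB : linear_op B.
  by move=> a x y; rewrite /B linA scalerDr !scalerBr !scalerA mulrC opprD addrACA.
have symB x y : rip (B x) y = rip x (B y) by rewrite /B !ripE sA.
have B1 x : hnorm (B x) <= hnorm x.
  apply: le_of_sqr => //; rewrite !hnorm_sqr -[X in _ <= X]mul1r -(expr1n _ 2).
  apply: symmetric_op_nsq => // y; rewrite /B !ripE -hA mul1r -/(nsq y).
  rewrite subr_ge0 lerBlDr lerDl mulrC ler_pdivrMr// (mulrC (nsq y)) qM.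
  by rewrite divr_ge0// ltW.
have [X [linX symX XX]] := sqrt_complement linB symB B1.
have hX x : nsq ((Num.sqrt M)%:C *: X x) = q x.
  rewrite nsqZr sqr_sqrtr ?ltW// /nsq symX XX /B opprB addrCA subrr addr0.
  by rewrite ripZr mulVKf ?gt_eqF// ripC hA.
exists (fun x => (Num.sqrt M)%:C *: X x) => //.
apply: (bounded_of_nsq _ (M := M)) => [a x y|x]; last by rewrite hX.
by rewrite linX scalerDr !scalerA mulrC.
Qed.

End SquareRoot.

(** * Completeness tested on squared norms *)

Section Completeness.
Variables (R : realType) (V : lmodType R[i]) (ip : V -> V -> R[i]).

Lemma ip_complete_of_sqr :
  (forall u : nat -> V, (forall e : R, 0 < e -> exists N, forall m n,
      (N <= m)%N -> (N <= n)%N -> complex.Re (ip (u m - u n) (u m - u n)) < e) ->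
    exists l, forall e : R, 0 < e -> exists N, forall n, (N <= n)%N ->
      complex.Re (ip (u n - l) (u n - l)) < e) ->
  forall u : nat -> V, ip_cauchy ip u -> exists l, ip_cvg_to ip u l.
Proof.
move=> h u hu; have [e e0|l hl] := h u.
  have [|N hN] := hu (Num.sqrt e); first by rewrite sqrtr_gt0.
  by exists N => m n hm hn; have := hN m n hm hn; rewrite /ip_norm ltr_sqrt.
exists l => e e0; have e2 : 0 < e ^+ 2 by rewrite exprn_gt0.
have [N hN] := hl _ e2; exists N => n /hN hn.
by rewrite /ip_norm -(ger0_norm (ltW e0)) -sqrtr_sqr ltr_sqrt.
Qed.
End Completeness.

(** * The complex line as a Hilbert space *)

Section ComplexLine.
Variable R : realType.

Definition line_ip (x y : R[i]^o) : R[i] := x * conjc y.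

Lemma line_ip_complete : forall u : nat -> R[i]^o, ip_cauchy line_ip u ->
  exists l, ip_cvg_to line_ip u l.
Proof.
have reE (z : R[i]^o) :
    complex.Re (line_ip z z) = complex.Re z ^+ 2 + complex.Im z ^+ 2.
  by case: z => a b; rewrite /line_ip /=; ring.
apply: ip_complete_of_sqr => u hu.
have sub (f : R[i] -> R) : (forall x y, f (x - y) = f x - f y) ->
    (forall z, f z ^+ 2 <= complex.Re z ^+ 2 + complex.Im z ^+ 2) ->
    exists l : R, (fun n => f (u n)) @ \oo --> l.
  move=> fB fle; apply: cauchy_cvgn => e e0.
  have [|N hN] := hu (e ^+ 2); first by rewrite exprn_gt0.
  exists N => m n hm hn; apply: lt_of_sqr => //; rewrite -fB.
  by apply: (le_lt_trans (fle _)); rewrite -reE; exact: hN.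
have [||a ha] := sub (@complex.Re R).
- by move=> [? ?] [? ?].
- by move=> z; rewrite lerDl sqr_ge0.
have [||b hb] := sub (@complex.Im R).
- by move=> [? ?] [? ?].
- by move=> z; rewrite lerDr sqr_ge0.
exists (Complex a b) => e e0.
have e2 : 0 < Num.sqrt (e / 2) by rewrite sqrtr_gt0 divr_gt0.
have [N1 h1] := eps_cvgn ha e2; have [N2 h2] := eps_cvgn hb e2.
exists (maxn N1 N2) => n; rewrite geq_max => /andP[/h1 hn1 /h2 hn2].
have sq (x : R) : `|x| < Num.sqrt (e / 2) -> x ^+ 2 < e / 2.
  move=> hx; rewrite -[x ^+ 2]real_normK ?num_real//.
  rewrite -(sqr_sqrtr (a := e / 2)) ?divr_ge0 ?ltW// ltr_sqr ?nnegrE//.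
  exact: ltW.
rewrite reE; have := sq _ hn1; have := sq _ hn2.
by case: (u n) => x y /=; lra.
Qed.

Definition line_hilbert : hilbert R.
Proof.
refine (@Hilbert R (R[i]^o : lmodType R[i]) line_ip _ _ _ _ line_ip_complete).
- by move=> a x y z; rewrite /line_ip mulrDl -mulrA.
- by move=> x y; rewrite /line_ip rmorphM /= conjcK mulrC.
- by move=> x; exact: mulcJ_ge0.
- by move=> x /eqP; rewrite mulf_eq0 conjc_eq0 orbb => /eqP.
Defined.

(** A copy of the line inside the multiplicity space makes both shift spaces nonzero, even when [H]
    is zero. *)
Lemma line_nontrivial : nontrivial line_hilbert.
Proof. by exists (1 : R[i]); rewrite oner_neq0. Qed.

End ComplexLine.

(** * Orthogonal direct sums *)

Section DirectSum.
Variables (R : realType) (K1 K2 : hilbert R).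

Definition sum_ip (x y : K1 * K2) : R[i] := hinner x.1 y.1 + hinner x.2 y.2.

Lemma Re_sum_ip x : complex.Re (sum_ip x x) = nsq x.1 + nsq x.2.
Proof. by rewrite /sum_ip !nsq_hinner. Qed.

Lemma sum_ip_complete : forall u : nat -> (K1 * K2)%type,
  ip_cauchy sum_ip u -> exists l, ip_cvg_to sum_ip u l.
Proof.
apply: ip_complete_of_sqr => u hu.
have [|l1 /cvg_toE h1] := @nsq_cauchy R K1 (fun n => (u n).1).
  move=> e /hu[N hN]; exists N => m n hm hn.
  by apply: le_lt_trans (hN m n hm hn); rewrite Re_sum_ip lerDl.
have [|l2 /cvg_toE h2] := @nsq_cauchy R K2 (fun n => (u n).2).
  move=> e /hu[N hN]; exists N => m n hm hn.
  by apply: le_lt_trans (hN m n hm hn); rewrite Re_sum_ip lerDr.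
exists (l1, l2) => e e0; have e2 : 0 < e / 2 by rewrite divr_gt0.
have [N1 hN1] := eps_cvgn h1 e2; have [N2 hN2] := eps_cvgn h2 e2.
exists (maxn N1 N2) => n; rewrite geq_max => /andP[/hN1 + /hN2].
by rewrite !subr0 !ger0_norm// Re_sum_ip /=; lra.
Qed.

Definition sum_hilbert : hilbert R.
Proof.
refine (@Hilbert R (K1 * K2)%type sum_ip _ _ _ _ sum_ip_complete).
- move=> a x y z; rewrite /sum_ip /= !hinnerDl; ring.
- by move=> x y; rewrite /sum_ip rmorphD /= -!hinner_conj.
- by move=> x; rewrite addr_ge0// hinner_ge0.
- move=> [x y] h; have := congr1 (@complex.Re R) h.
  rewrite Re_sum_ip => /= hxy; congr pair; apply: nsq_le0.
    by rewrite -hxy lerDl.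
  by rewrite -hxy lerDr.
Defined.

Lemma rip_sum (x y : sum_hilbert) : rip x y = rip x.1 y.1 + rip x.2 y.2.
Proof. by rewrite {1}/rip /= /sum_ip !hinner_rip. Qed.

Lemma nsq_sum (x : sum_hilbert) : nsq x = nsq x.1 + nsq x.2.
Proof. exact: rip_sum. Qed.

Definition inl_sum (x : K1) : sum_hilbert := (x, 0).
Definition inr_sum (y : K2) : sum_hilbert := (0, y).

Lemma inl_sum_lin : linear_op inl_sum.
Proof.
move=> a x y.
have -> : a *: inl_sum x + inl_sum y = (a *: x + y, a *: 0 + 0) by [].
by rewrite scaler0 addr0.
Qed.

Lemma inr_sum_lin : linear_op inr_sum.
Proof.
move=> a x y.
have -> : a *: inr_sum x + inr_sum y = (a *: 0 + 0, a *: x + y) by [].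
by rewrite scaler0 addr0.
Qed.

Lemma sum_embedding :
  embedding inl_sum /\ embedding inr_sum.
Proof.
split; apply: isometry_nsq; [exact: inl_sum_lin| |exact: inr_sum_lin|] => x.
- by rewrite nsq_sum nsq0 addr0.
- by rewrite nsq_sum nsq0 add0r.
Qed.

Lemma sum_orth_decomp : orth_decomp inl_sum inr_sum.
Proof.
have [el er] := sum_embedding; do 2 split=> //; apply/seteqP; split.
  move=> _ [x ->] _ [y ->]; apply: rip_eq0; rewrite rip_sum ?rip0l ?rip0r.
    by rewrite addr0.
  by rewrite /= scaler0 rip0r addr0.
move=> [x y] h; exists x; congr pair.
apply: nsq_eq0; have := h (inr_sum y); rewrite /range_of /orth => h'.
have : rip ((x, y) : sum_hilbert) (inr_sum y) = 0.
  by rewrite /rip h'//; exists y.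
by rewrite rip_sum rip0r add0r.
Qed.

Lemma adj_inr_sum (k : sum_hilbert) : adj inr_sum k = k.2.
Proof.
apply: (adj_uniq (B := fun k : sum_hilbert => k.2)).
apply: (is_adjoint_rip inr_sum_lin) => x y.
by rewrite rip_sum rip0l add0r.
Qed.

End DirectSum.


(** * Orthogonal complements as Hilbert spaces *)

Section OrthogonalSubspace.
Variables (R : realType) (K : hilbert R) (A : set K).

(** The boolean form of [orth A] lets the subtype inherit the module structure of [K]. *)
Definition in_orth : {pred K} := fun x => `[< orth A x >].

Lemma in_orth_submod : submod_closed in_orth.
Proof.
split=> [|a x y /asboolP hx /asboolP hy]; apply/asboolP => z Az.
  exact: hinner0l.
by rewrite hinnerDl hx// hy// mulr0 addr0.
Qed.
HB.instance Definition _ := GRing.isSubmodClosed.Build R[i] K in_orth in_orth_submod.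

Record orth_type := OrthType { orth_val : K; orth_valP : in_orth orth_val }.
HB.instance Definition _ := [isSub for orth_val].
HB.instance Definition _ := [Choice of orth_type by <:].
HB.instance Definition _ := [SubChoice_isSubLmodule of orth_type by <:].

Lemma orth_valB (x y : orth_type) : orth_val (x - y) = orth_val x - orth_val y.
Proof. exact: (raddfB (val : orth_type -> K)). Qed.

Lemma orth_val_lin (a : R[i]) (x y : orth_type) :
  orth_val (a *: x + y) = a *: orth_val x + orth_val y.
Proof. exact: (linearP (val : orth_type -> K)). Qed.

Definition orth_ip (x y : orth_type) : R[i] := hinner (orth_val x) (orth_val y).

(** A limit taken in [K] stays orthogonal to [A] because the inner product is continuous. *)
Lemma orth_ip_complete : forall u : nat -> orth_type, ip_cauchy orth_ip u ->
  exists l, ip_cvg_to orth_ip u l.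
Proof.
move=> u hu.
have [|l hl] := @hcomplete R K (fun n => orth_val (u n)).
  by move=> e /hu[N hN]; exists N => m n hm hn; have := hN m n hm hn;
    rewrite /ip_norm /orth_ip orth_valB.
have Al : in_orth l.
  apply/asboolP => z Az; apply: rip_eq0.
    apply: (cvgn_uniq (cvg_to_rip hl (cvg_to_cst z))).
    have -> : (fun n => rip (orth_val (u n)) z) = fun=> 0.
      by apply/funext => n; rewrite /rip (asboolW (orth_valP (u n))).
    exact: cvg_cst.
  apply: (cvgn_uniq (cvg_to_rip hl (cvg_to_cst _))).
  have -> : (fun n => rip (orth_val (u n)) ('i *: z)) = fun=> 0.
    apply/funext => n.
    by rewrite /rip hinnerZr (asboolW (orth_valP (u n)))// mulr0.
  exact: cvg_cst.
exists (OrthType Al) => e /hl[N hN]; exists N => n hn; have := hN n hn.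
by rewrite /ip_norm /orth_ip orth_valB.
Qed.

Definition orth_hilbert : hilbert R.
Proof.
refine (@Hilbert R (orth_type : lmodType R[i]) orth_ip _ _ _ _ orth_ip_complete).
- by move=> a x y z; rewrite /orth_ip orth_val_lin hinnerDl.
- by move=> x y; exact: hinner_conj.
- by move=> x; exact: hinner_ge0.
- by move=> x h; apply/val_inj/hinner_eq0.
Defined.

End OrthogonalSubspace.

(** * Square-summable sequences with values in a Hilbert space *)

Section SquareSummable.
Variables (R : realType) (G : hilbert R).

Definition sq_summable : {pred nat -> G} :=
  fun f => `[< exists M, forall n, \sum_(i < n) nsq (f i) <= M >].

Lemma sq_summable_submod : submod_closed sq_summable.
Proof.
split=> [|a f g /asboolP[M hM] /asboolP[N hN]]; apply/asboolP.
  by exists 0 => n; rewrite big1// => i _; exact: nsq0.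
exists (2 * ((complex.Re a ^+ 2 + complex.Im a ^+ 2) * M + N)) => n.
apply: (@le_trans _ _ (\sum_(i < n) 2 * ((complex.Re a ^+ 2 +
    complex.Im a ^+ 2) * nsq (f i) + nsq (g i)))).
  by apply: ler_sum => i _; apply: (le_trans (nsqD_le _ _)); rewrite nsqZ.
rewrite -mulr_sumr ler_pM2l// big_split /= -mulr_sumr; apply: lerD.
  by apply: ler_wpM2l; [apply: addr_ge0; exact: sqr_ge0 | exact: hM].
exact: hN.
Qed.
HB.instance Definition _ :=
  GRing.isSubmodClosed.Build R[i] (nat -> G) sq_summable sq_summable_submod.

Record ell2 := Ell2 { ell2_val :> nat -> G; ell2_valP : sq_summable ell2_val }.
HB.instance Definition _ := [isSub for ell2_val].
HB.instance Definition _ := [Choice of ell2 by <:].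
HB.instance Definition _ := [SubChoice_isSubLmodule of ell2 by <:].

Implicit Types u v w : ell2.

Lemma ell2_linE (a : R[i]) u v i : (a *: u + v) i = a *: u i + v i.
Proof.
by rewrite -[ell2_val _]/(val (a *: u + v)) (linearP (val : ell2 -> nat -> G)).
Qed.

Lemma ell2_addE u v i : (u + v) i = u i + v i.
Proof. by rewrite -[u]scale1r ell2_linE !scale1r. Qed.

Lemma ell2_zeroE i : (0 : ell2) i = 0.
Proof. by apply: (addrI ((0 : ell2) i)); rewrite -ell2_addE !addr0. Qed.

Lemma ell2_scaleE (a : R[i]) u i : (a *: u) i = a *: u i.
Proof. by rewrite -[a *: u]addr0 ell2_linE ell2_zeroE addr0. Qed.

Lemma ell2_subE u v i : (u - v) i = u i - v i.
Proof. by rewrite ell2_addE -[- v]scaleN1r ell2_scaleE scaleN1r. Qed.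

Lemma ell2_ext u v : (forall i, u i = v i) -> u = v.
Proof. by move=> h; apply: val_inj; apply/funext. Qed.

Lemma ell2_nsq_cvg u : exists l : R,
  [/\ (fun n => \sum_(i < n) nsq (u i)) @ \oo --> l,
      forall n, \sum_(i < n) nsq (u i) <= l &
      forall M, (forall n, \sum_(i < n) nsq (u i) <= M) -> l <= M].
Proof.
have mono n : \sum_(i < n) nsq (u i) <= \sum_(i < n.+1) nsq (u i).
  by rewrite big_ord_recr /= lerDl.
have /asboolP[M hM] := ell2_valP u.
have [l [h1 h2 _]] := monotone_cvgn mono hM; exists l; split=> // N hN.
exact: (cvgn_le h1 (cvg_cst N)).
Qed.

(** Polarisation reduces this to the series of squares of [u], [v] and [u + v]. *)
Lemma ell2_rip_is_cvg u v : exists l : R,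
  (fun n => \sum_(i < n) rip (u i) (v i)) @ \oo --> l.
Proof.
have [a [ha _ _]] := ell2_nsq_cvg u; have [b [hb _ _]] := ell2_nsq_cvg v.
have [c [hc _ _]] := ell2_nsq_cvg (u + v).
exists (2^-1 * (c - a - b)).
have -> : (fun n => \sum_(i < n) rip (u i) (v i)) = (fun n =>
    2^-1 * (\sum_(i < n) nsq ((u + v) i) - \sum_(i < n) nsq (u i) -
    \sum_(i < n) nsq (v i))).
  apply/funext => n; rewrite -!sumrB mulr_sumr; apply: eq_bigr => i _.
  by rewrite ell2_addE nsqD; field.
by apply: cvgM; [exact: cvg_cst | apply: cvgB => //; exact: cvgB].
Qed.

Definition ell2_rip u v : R := limn (fun n => \sum_(i < n) rip (u i) (v i)).

Lemma ell2_rip_cvg u v :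
  (fun n => \sum_(i < n) rip (u i) (v i)) @ \oo --> ell2_rip u v.
Proof. by have [l hl] := ell2_rip_is_cvg u v; apply/cvg_ex; exists l. Qed.

Lemma ell2_ripE u v l : (fun n => \sum_(i < n) rip (u i) (v i)) @ \oo --> l ->
  ell2_rip u v = l.
Proof. exact/cvgn_uniq/ell2_rip_cvg. Qed.

(** The complex product is rebuilt from its real part by the formula of [hinner_rip], so only real
    series have to converge. *)
Definition ell2_ip u v : R[i] := Complex (ell2_rip u v) (ell2_rip u ('i *: v)).

Lemma ell2_rip_lin (a : R[i]) u v w : ell2_rip (a *: u + v) w =
  complex.Re a * ell2_rip u w - complex.Im a * ell2_rip u ('i *: w) +
  ell2_rip v w.
Proof.
apply: ell2_ripE.
have -> : (fun n => \sum_(i < n) rip ((a *: u + v) i) (w i)) = (fun n =>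
    complex.Re a * (\sum_(i < n) rip (u i) (w i)) -
    complex.Im a * (\sum_(i < n) rip (u i) (('i *: w) i)) +
    \sum_(i < n) rip (v i) (w i)).
  apply/funext => n; rewrite !mulr_sumr -sumrB -big_split; apply: eq_bigr => i _.
  rewrite ell2_linE ell2_scaleE ripDl; congr (_ + _).
  by rewrite {1}/rip hinnerZ hinner_rip; case: a => p q /=.
apply: cvgD; last exact: ell2_rip_cvg.
by apply: cvgB; apply: cvgM; (exact: cvg_cst || exact: ell2_rip_cvg).
Qed.

Lemma ell2_ripC u v : ell2_rip u v = ell2_rip v u.
Proof.
apply: ell2_ripE; under eq_fun do under eq_bigr do rewrite ripC.
exact: ell2_rip_cvg.
Qed.

Lemma ell2_ripZ (a : R[i]) u v : ell2_rip (a *: u) v =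
  complex.Re a * ell2_rip u v - complex.Im a * ell2_rip u ('i *: v).
Proof.
have e0 : ell2_rip 0 v = 0.
  apply: ell2_ripE.
  have -> : (fun n => \sum_(i < n) rip ((0 : ell2) i) (v i)) = fun=> 0.
    by apply/funext => n; rewrite big1// => i _; rewrite ell2_zeroE rip0l.
  exact: cvg_cst.
by rewrite -[a *: u]addr0 ell2_rip_lin e0 addr0.
Qed.

Lemma ell2_rip_i u v : ell2_rip ('i *: u) v = - ell2_rip u ('i *: v).
Proof. by rewrite ell2_ripZ /=; ring. Qed.

Lemma ell2_ip_nsq u : exists l : R, [/\ ell2_ip u u = l%:C,
  forall n, \sum_(i < n) nsq (u i) <= l &
  forall M, (forall n, \sum_(i < n) nsq (u i) <= M) -> l <= M].
Proof.
have [l [h1 h2 h3]] := ell2_nsq_cvg u; exists l; split=> //.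
rewrite /ell2_ip (ell2_ripE h1); congr Complex.
by have := ell2_rip_i u u; rewrite ell2_ripC; lra.
Qed.

Lemma ell2_ip_complete : forall u : nat -> ell2, ip_cauchy ell2_ip u ->
  exists l, ip_cvg_to ell2_ip u l.
Proof.
apply: ip_complete_of_sqr => u hu.
have part v n : \sum_(i < n) nsq (v i) <= complex.Re (ell2_ip v v).
  by have [l [-> h _]] := ell2_ip_nsq v.
have coord v i : nsq (v i) <= complex.Re (ell2_ip v v).
  apply: le_trans (part v i.+1); rewrite big_ord_recr /= lerDr.
  exact: sumr_ge0.
have /boolp.choice[f hf] : forall i, exists l, cvg_to (fun n => u n i) l.
  move=> i; apply: nsq_cauchy => e /hu[N hN]; exists N => m n hm hn.
  by rewrite -ell2_subE; apply: (le_lt_trans (coord _ _)); exact: hN.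
(* The Cauchy bound restricted to finitely many coordinates survives the coordinatewise limit in
   [n], uniformly in the number of coordinates. *)
have lim e N : (forall m n, (N <= m)%N -> (N <= n)%N ->
    complex.Re (ell2_ip (u m - u n) (u m - u n)) < e) ->
    forall m k, (N <= m)%N -> \sum_(i < k) nsq (u m i - f i) <= e.
  move=> h m k hm.
  have hc : (fun n => \sum_(i < k) nsq (u m i - u (n + N)%N i)) @ \oo
      --> \sum_(i < k) nsq (u m i - f i).
    apply: cvg_big => [x|i _]; first exact: add_continuous.
    apply: cvg_to_nsq; apply: cvg_toB; first exact: cvg_to_cst.
    apply/cvg_toE; have /cvg_toE := hf i.
    by rewrite -(cvg_shiftn N (fun n => nsq (u n i - f i))).
  apply: (cvgn_le hc (cvg_cst e)) => n.
  have := ltW (h m (n + N)%N hm (leq_addl _ _)); apply: le_trans.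
  apply: le_trans (part _ k); apply: ler_sum => i _.
  by rewrite ell2_subE.
(* The limit [f] is square-summable since it is within finite distance of the member [u N0]. *)
have [|N0 hN0] := hu 1; first by [].
have sf : sq_summable f.
  apply/asboolP; have /asboolP[M hM] := ell2_valP (u N0).
  exists (2 * (M + 1)) => n.
  apply: (@le_trans _ _ (\sum_(i < n) 2 * (nsq (u N0 i) + nsq (u N0 i - f i)))).
    apply: ler_sum => i _; rewrite (nsqBC _ (f i)).
    by apply: le_trans (nsqD_le _ _); rewrite addrC subrK.
  by rewrite -mulr_sumr ler_pM2l// big_split lerD// (lim _ N0).
exists (Ell2 sf) => e e0; have e2 : 0 < e / 2 by rewrite divr_gt0.
have [N hN] := hu _ e2; exists N => n hn.
have [l [-> _ h]] := ell2_ip_nsq (u n - Ell2 sf).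
apply: (@le_lt_trans _ _ (e / 2)); last by lra.
apply: h => k; apply: le_trans (lim _ _ hN n k hn).
by apply: ler_sum => i _; rewrite ell2_subE.
Qed.

Definition ell2_hilbert : hilbert R.
Proof.
refine (@Hilbert R (ell2 : lmodType R[i]) ell2_ip _ _ _ _ ell2_ip_complete).
- move=> a u v w; rewrite /ell2_ip !ell2_rip_lin.
  have -> : ell2_rip u ('i *: ('i *: w)) = - ell2_rip u w.
    by rewrite ell2_ripC scalerA -expr2 sqr_i ell2_ripZ /= oppr0 ell2_ripC; ring.
  by case: a => p q /=; apply/eqP; rewrite eq_complex /=; apply/andP;
     split; apply/eqP; ring.
- move=> u v; rewrite /ell2_ip /= ell2_ripC; congr Complex.
  by rewrite ell2_ripC ell2_rip_i.
- move=> u; have [l [-> h _]] := ell2_ip_nsq u.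
  by rewrite ler0c; have := h 0%N; rewrite big_ord0.
- move=> u; have [l [-> h _]] := ell2_ip_nsq u => [[l0]].
  apply: ell2_ext => i; rewrite ell2_zeroE; apply: nsq_le0.
  rewrite -l0; apply: le_trans (h i.+1); rewrite big_ord_recr /= lerDr.
  exact: sumr_ge0.
Defined.

End SquareSummable.

(** * The unilateral shift *)

Section Shift.
Variables (R : realType) (G : hilbert R).
Local Notation l2 := (ell2_hilbert G).
Implicit Types (u v : ell2 G) (g : G).

Lemma rip_ell2_cvg u v :
  (fun n => \sum_(i < n) rip (u i) (v i)) @ \oo --> rip (u : l2) (v : l2).
Proof. exact: ell2_rip_cvg. Qed.

Lemma nsq_ell2E u : nsq (u : l2) = complex.Re (ell2_ip u u).
Proof. by []. Qed.

Lemma nsq_ell2_ge u n : \sum_(i < n) nsq (u i) <= nsq (u : l2).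
Proof.
by rewrite nsq_ell2E; have [l [-> h _]] := ell2_ip_nsq u.
Qed.

Lemma nsq_ell2_lub u M : (forall n, \sum_(i < n) nsq (u i) <= M) ->
  nsq (u : l2) <= M.
Proof.
by rewrite nsq_ell2E; have [l [-> _ h]] := ell2_ip_nsq u => /h.
Qed.

Lemma nsq_coord_le u i : nsq (u i) <= nsq (u : l2).
Proof.
apply: le_trans (nsq_ell2_ge u i.+1); rewrite big_ord_recr /= lerDr.
exact: sumr_ge0.
Qed.

Lemma rip_supported u v n : (forall i, i != n -> u i = 0) ->
  rip (u : l2) (v : l2) = rip (u n) (v n).
Proof.
move=> h; apply: (cvgn_uniq (@rip_ell2_cvg u v)).
(* From [n.+1] terms on, the partial sums contain the index [n] and are constant. *)
rewrite -(cvg_shiftn n.+1).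
have -> : (fun m => \sum_(i < m + n.+1) rip (u i) (v i)) =
    fun=> rip (u n) (v n).
  apply/funext => m; have hn : (n < m + n.+1)%N by rewrite addnS ltnS leq_addl.
  rewrite (bigD1 (Ordinal hn))//= big1 ?addr0// => i; rewrite -val_eqE /= => hi.
  by rewrite h// rip0l.
exact: cvg_cst.
Qed.

Definition shift_fun (f : nat -> G) (n : nat) : G := if n is m.+1 then f m else 0.

Lemma sum_shift_fun (f : nat -> G) n :
  \sum_(i < n.+1) nsq (shift_fun f i) = \sum_(i < n) nsq (f i).
Proof. by rewrite big_ord_recl /= nsq0 add0r. Qed.

Lemma shift_summable u : sq_summable (shift_fun u).
Proof.
apply/asboolP; exists (nsq (u : l2)) => -[|n]; first by rewrite big_ord0.
by rewrite sum_shift_fun nsq_ell2_ge.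
Qed.

Definition shift (u : l2) : l2 := Ell2 (shift_summable u).

Lemma shift_lin : linear_op shift.
Proof.
move=> a x y; apply: ell2_ext => i; rewrite ell2_linE.
by case: i => [|i] /=; rewrite ?scaler0 ?addr0// ell2_linE.
Qed.

Lemma nsq_shift (u : l2) : nsq (shift u) = nsq u.
Proof.
apply/eqP; rewrite eq_le; apply/andP; split.
  apply: nsq_ell2_lub => -[|n]; first by rewrite big_ord0.
  by rewrite sum_shift_fun nsq_ell2_ge.
apply: nsq_ell2_lub => n; rewrite -sum_shift_fun.
exact: (nsq_ell2_ge (shift u)).
Qed.

Lemma single_summable g : sq_summable (fun n => if n == 0%N then g else 0).
Proof.
apply/asboolP; exists (nsq g) => -[|n]; first by rewrite big_ord0.
by rewrite big_ord_recl /= big1 ?addr0// => i _; exact: nsq0.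
Qed.

(** The copy of [G] in coordinate 0, the wandering subspace of the shift. *)
Definition single g : l2 := Ell2 (single_summable g).

Lemma single_lin : linear_op single.
Proof.
move=> a x y; apply: ell2_ext => i; rewrite ell2_linE /=.
by case: eqP => // _; rewrite scaler0 addr0.
Qed.

Lemma rip_single g v : rip (single g) (v : l2) = rip g (v 0%N).
Proof. by rewrite (rip_supported v (n := 0)) //= => i /negbTE ->. Qed.

Lemma nsq_single g : nsq (single g) = nsq g.
Proof. by rewrite {1}/nsq rip_single. Qed.

Lemma rip_shift_single (u : l2) g : rip (shift u) (single g) = 0.
Proof. by rewrite ripC rip_single /= rip0r. Qed.

Lemma iter_shift_single n g i :
  ell2_val (iter n shift (single g)) i = if i == n then g else 0.
Proof.
by elim: n i => [|n IH] [|i] //=.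
Qed.

Lemma rip_iter_shift n g v : rip (iter n shift (single g)) (v : l2) = rip g (v n).
Proof.
rewrite (rip_supported v (n := n)) => [|i /negbTE h]; rewrite iter_shift_single ?eqxx//.
by rewrite h.
Qed.

Lemma shift_unilateral : unilateral_shift shift.
Proof.
have [bV iV] := isometry_nsq shift_lin nsq_shift.
split=> //; split=> //; exists (fun u : l2 => forall i, ell2_val u i.+1 = 0).
have singleE (a : l2) : (forall i, ell2_val a i.+1 = 0) ->
    a = single (ell2_val a 0%N).
  by move=> h; apply: ell2_ext => -[|i] //=; rewrite h.
split; [split; [|split]|split].
- by move=> i; exact: ell2_zeroE.
- by move=> a x y hx hy i; rewrite ell2_linE hx hy scaler0 addr0.
- move=> u l hu /cvg_toE hl i; apply: nsq_le0.
  apply: (cvgn_le (cvg_cst _) hl) => n.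
  apply: le_trans (nsq_coord_le _ i.+1).
  by rewrite ell2_subE hu sub0r nsqN.
- move=> m n /eqP mn a b /singleE -> /singleE ->.
  by apply: rip_eq0; rewrite rip_iter_shift ?ell2_scaleE iter_shift_single
    (negbTE mn) ?scaler0 rip0r.
(* Pairing [x] with the [n]-th shift of its own coordinate [x n] gives [nsq (x n)], which therefore
   vanishes. *)
- apply: dense_of_orth => x h; apply: ell2_ext => n; rewrite ell2_zeroE.
  apply: nsq_eq0; rewrite /nsq -rip_iter_shift ripC /rip h//.
  by exists n, (single (ell2_val x n)).
Qed.

End Shift.

(** * Successive extensions [Q_(j+1) T = Q_j] *)

Section BackwardOrbit.
Variables (R : realType) (H E F : hilbert R).
Variables (T : H -> H) (Z : H -> E) (Q0 : H -> F).
Hypothesis bT : bounded_op T.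
Hypothesis bZ : bounded_op Z.
Hypothesis bQ0 : bounded_op Q0.
Hypothesis Q0Z : forall x, nsq (Q0 x) + nsq (Z x) <= nsq (Z (T x)).

Let V x := Z (T x).

Let bV : bounded_op V. Proof. exact: bounded_comp. Qed.
Let linV : linear_op V. Proof. exact: bounded_lin. Qed.

(** The vector [p x] is the projection of [Z x] onto the closure of the range of [V]. The
    approximants [V (w x n)] are kept because a factor through [V] is known only on that range and
    must be extended by limits. *)
Lemma projection_range : exists (p : H -> E) (w : H -> nat -> H),
  (forall x, cvg_to (fun n => V (w x n)) (p x)) /\
  (forall x y, rip (Z x - p x) (V y) = 0).
Proof.
have h x : exists pw : E * (nat -> H), cvg_to (fun n => V (pw.2 n)) pw.1 /\
    forall y, rip (Z x - pw.1) (V y) = 0.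
  have [||p [u [hu up hp]]] := @projection_subspace R E (range_of V) (Z x).
  - by exists 0; rewrite (linear_op0 linV).
  - by move=> a _ _ [x1 ->] [x2 ->]; exists (a *: x1 + x2); rewrite linV.
  have /boolp.choice[w hw] := hu; exists (p, w); split => /=.
    by have -> : (fun n => V (w n)) = u by apply/funext.
  by move=> y; apply: hp; exists y.
have /boolp.choice[f hf] := h.
by exists (fun x => (f x).1), (fun x => (f x).2); split=> x; case: (hf x).
Qed.

Let p := projT1 (cid projection_range).
Let w := projT1 (cid (projT2 (cid projection_range))).

Let wp x : cvg_to (fun n => V (w x n)) (p x).
Proof. exact: (projT2 (cid (projT2 (cid projection_range)))).1. Qed.

Let pV x y : rip (Z x - p x) (V y) = 0.
Proof. exact: (projT2 (cid (projT2 (cid projection_range)))).2. Qed.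

Let range_orth_eq0 (d : nat -> H) (e : E) : cvg_to (fun n => V (d n)) e ->
  (forall y, rip e (V y) = 0) -> e = 0.
Proof.
move=> hd he; apply: nsq_eq0.
apply: (cvgn_uniq (cvg_to_rip (cvg_to_cst e) hd)).
have -> : (fun n => rip e (V (d n))) = fun=> 0 by apply/funext => n.
exact: cvg_cst.
Qed.

Let p_nsq x : nsq (p x) <= nsq (Z x).
Proof.
have h : rip (Z x - p x) (p x) = 0.
  apply: (cvgn_uniq (cvg_to_rip (cvg_to_cst _) (wp x))).
  have -> : (fun n => rip (Z x - p x) (V (w x n))) = fun=> 0.
    by apply/funext => n.
  exact: cvg_cst.
rewrite -(subrK (p x) (Z x)) nsqD h mulr0 addr0.
by rewrite lerDr.
Qed.

(** The chosen [w] is linear in [x] only up to sequences that [V] sends to 0: the limit lies in the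
    closed range of [V] and is orthogonal to it. By [dominated_null], maps dominated by [V] do not
    see this defect either. *)
Let w_lin a x y : cvg_to (fun n => V (a *: w x n + w y n - w (a *: x + y) n)) 0.
Proof.
have hd : cvg_to (fun n => V (a *: w x n + w y n - w (a *: x + y) n))
    (a *: p x + p y - p (a *: x + y)).
  have -> : (fun n => V (a *: w x n + w y n - w (a *: x + y) n)) =
      fun n => a *: V (w x n) + V (w y n) - V (w (a *: x + y) n).
    by apply/funext => n; rewrite (linear_opB linV) linV.
  by apply: cvg_toB (wp _); apply: cvg_toD (wp _); exact: cvg_toZ.
rewrite -[X in cvg_to _ X](range_orth_eq0 hd) // => z.
have e u v : rip (p u) (V v) = rip (Z u) (V v).
  by have := pV u v; rewrite !ripE; lra.
have eh u v : hinner (p u) (V v) = hinner (Z u) (V v).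
  by rewrite !hinner_rip -(linear_opZ linV) !e.
rewrite !ripE !e (bounded_lin bZ) ripDl /rip !hinnerZ eh.
by rewrite subrr.
Qed.

(** Because [Z (T x)] is [V x], the projection changes nothing and [x] itself serves as approximant;
    this is the source of [backwardT]. *)
Let w_T x : cvg_to (fun n => V (w (T x) n - x)) 0.
Proof.
have hd : cvg_to (fun n => V (w (T x) n - x)) (p (T x) - V x).
  have -> : (fun n => V (w (T x) n - x)) = fun n => V (w (T x) n) - V x.
    by apply/funext => n; rewrite (linear_opB linV).
  exact: cvg_toB (wp _) (cvg_to_cst _).
rewrite -[X in cvg_to _ X](range_orth_eq0 hd) // => z.
by rewrite -opprB ripNl pV oppr0.
Qed.

Let dominated_null (Q : H -> F) (d : nat -> H) :
  (forall y, nsq (Q y) <= nsq (V y)) -> cvg_to (fun n => V (d n)) 0 ->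
  cvg_to (fun n => Q (d n)) 0.
Proof.
move=> hQ /cvg_toE hd; apply/cvg_toE; move: hd; apply: squeeze0 => n.
by rewrite !subr0 nsq_ge0 hQ.
Qed.

(** The limit is the factor of [backward m] through [V], extended to the closed range of [V] and
    evaluated at [p x]. Using [epsilon] postpones the existence of the limit to [backward_cvg]. *)
Fixpoint backward n : H -> F := if n is m.+1 then
  fun x => epsilon (inhabits 0) (cvg_to (fun k => backward m (w x k))) else Q0.

(** Domination by [V] transfers the Cauchy property from the convergent sequence [V (w x n)]. *)
Lemma backward_cvg k x : linear_op (backward k) ->
  (forall y, nsq (backward k y) <= nsq (V y)) ->
  cvg_to (fun n => backward k (w x n)) (backward k.+1 x).
Proof.
move=> lin h; apply: epsilon_spec; apply: nsq_cauchy => e e0.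
have /cvg_toE hp := wp x.
have [|N hN] := eps_cvgn hp (e := e / 4); first by rewrite divr_gt0.
exists N => m n /hN + /hN; rewrite !subr0 !ger0_norm// => hm hn.
rewrite -(linear_opB lin); apply: (le_lt_trans (h _)).
rewrite (linear_opB linV) -(subrK (p x) (V (w x m))) -addrA.
apply: (le_lt_trans (nsqD_le _ _)); rewrite (nsqBC (p x)).
by move: hm hn; lra.
Qed.

(** Both claims advance together: the sum bound at [k], combined with [Q0Z], dominates
    [Q_0, ..., Q_k] by [V], so their next limits exist and are linear. *)
Lemma backward_spec k : (forall j, (j <= k)%N -> linear_op (backward j)) /\
  (forall y, \sum_(j < k) nsq (backward j.+1 y) <= nsq (Z y)).
Proof.
elim: k => [|k [lin leZ]].
  by split=> [[|//] _|y]; [exact: bounded_lin | rewrite big_ord0].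
have le y : \sum_(j < k.+1) nsq (backward j y) <= nsq (V y).
  by rewrite big_ord_recl; apply: le_trans (Q0Z y); rewrite lerD2l; exact: leZ.
have le1 j y : (j <= k)%N -> nsq (backward j y) <= nsq (V y).
  move=> jk; apply: le_trans (le y); rewrite -ltnS in jk.
  rewrite (bigD1 (Ordinal jk)) //= lerDl; exact: sumr_ge0.
have cv j x : (j <= k)%N ->
    cvg_to (fun n => backward j (w x n)) (backward j.+1 x).
  by move=> jk; apply: backward_cvg; [exact: lin | move=> y; exact: le1].
split.
  move=> [|j]; first by move=> _; exact: bounded_lin.
  rewrite ltnS => jk a x y; apply/esym/eqP; rewrite -subr_eq0; apply/eqP.
  have := dominated_null (fun y => le1 j y jk) (w_lin a x y).
  apply: cvg_to_uniq.
  have -> : (fun n => backward j (a *: w x n + w y n - w (a *: x + y) n)) =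
      fun n => a *: backward j (w x n) + backward j (w y n) -
        backward j (w (a *: x + y) n).
    by apply/funext => n; rewrite (linear_opB (lin j jk)) lin.
  by apply: cvg_toB (cv _ _ jk); apply: cvg_toD (cv _ _ jk); apply: cvg_toZ;
    exact: cv.
(* The whole sum is dominated by [nsq (V (w y n))] before the limit is taken, so the bound does not
   grow with [k]. *)
move=> y; apply: le_trans (p_nsq y).
have hs : (fun n => \sum_(j < k.+1) nsq (backward j (w y n))) @ \oo -->
    \sum_(j < k.+1) nsq (backward j.+1 y).
  apply: cvg_big => [x|j _]; first exact: add_continuous.
  by apply/cvg_to_nsq/cv; rewrite -ltnS.
by apply: (cvgn_le hs (cvg_to_nsq (wp y))) => n; exact: le.
Qed.

Lemma backward_lin k : linear_op (backward k).
Proof. by have [h _] := backward_spec k; exact: h. Qed.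

Lemma backward_sum_le n x : \sum_(j < n) nsq (backward j.+1 x) <= nsq (Z x).
Proof. by have [_] := backward_spec n. Qed.

Lemma backward_le k y : nsq (backward k y) <= nsq (V y).
Proof.
apply: le_trans (Q0Z y); case: k => [|k]; first by rewrite lerDl.
apply: le_trans (_ : nsq (Z y) <= _); last by rewrite lerDr.
apply: le_trans (backward_sum_le k.+1 y).
by rewrite big_ord_recr /= lerDr; exact: sumr_ge0.
Qed.

Lemma backwardT k x : backward k.+1 (T x) = backward k x.
Proof.
have h1 := backward_cvg (T x) (@backward_lin k) (@backward_le k).
have h2 := dominated_null (@backward_le k) (w_T x).
have := cvg_toD h2 (cvg_to_cst (backward k x)); rewrite add0r.
apply: cvg_to_uniq.
have -> // : (fun n => backward k (w (T x) n - x) + backward k x) =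
  (fun n => backward k (w (T x) n)).
by apply/funext => n; rewrite (linear_opB (@backward_lin k)) subrK.
Qed.

Lemma backward_summable x : sq_summable (fun j => backward j.+1 x).
Proof. by apply/asboolP; exists (nsq (Z x)) => n; exact: backward_sum_le. Qed.

(* The sequence [Q_1, Q_2, ...] of successive extensions, [Q_(j+1) T = Q_j],
   forms a single column operator, on which [T] acts as a forward shift. *)
Lemma backward_column : exists Q : H -> ell2_hilbert F, [/\ bounded_op Q,
  (forall x, nsq (Q x) <= nsq (Z x)) &
  (forall x, nsq (Q (T x)) = nsq (Q0 x) + nsq (Q x))].
Proof.
pose Q x : ell2_hilbert F := Ell2 (backward_summable x).
have QZ x : nsq (Q x) <= nsq (Z x).
  by apply: nsq_ell2_lub => n; exact: backward_sum_le.
exists Q; split=> // [|x].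
  have [M M0 hM] := bounded_nsq bZ; apply: (bounded_of_nsq _ (M := M)).
    by move=> a x y; apply: ell2_ext => i; rewrite ell2_linE; exact: backward_lin.
  by move=> x; exact: le_trans (QZ x) (hM x).
have sumT n : \sum_(j < n.+1) nsq (backward j.+1 (T x)) =
    nsq (Q0 x) + \sum_(j < n) nsq (backward j.+1 x).
  by rewrite big_ord_recl backwardT; congr (_ + _); apply: eq_bigr => j _;
    rewrite backwardT.
apply/eqP; rewrite eq_le; apply/andP; split.
  apply: nsq_ell2_lub => -[|n]; first by rewrite big_ord0 addr_ge0.
  by rewrite sumT lerD2l; exact: (nsq_ell2_ge (Q x)).
rewrite addrC -lerBrDr; apply: nsq_ell2_lub => n.
rewrite lerBrDr addrC -sumT; exact: (nsq_ell2_ge (Q (T x))).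
Qed.

End BackwardOrbit.

(** * Upper triangular block operators *)

Section BlockOperator.
Variables (R : realType) (K1 K2 : hilbert R).
Variables (A : K1 -> K1) (B : K2 -> K1) (D : K2 -> K2).
Hypotheses (bA : bounded_op A) (bB : bounded_op B) (bD : bounded_op D).
Hypothesis AB0 : forall x y, rip (A x) (B y) = 0.

Definition block_op (k : sum_hilbert K1 K2) : sum_hilbert K1 K2 :=
  (A k.1 + B k.2, D k.2).

(** Pythagoras: [AB0] says that the ranges of [A] and [B] are orthogonal. The form of each lifting
    is computed from this. *)
Lemma nsq_block_op k :
  nsq (block_op k) = nsq (A k.1) + nsq (B k.2) + nsq (D k.2).
Proof. by rewrite nsq_sum nsqD AB0 mulr0 addr0. Qed.

Lemma block_op_bounded : bounded_op block_op.
Proof.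
have [a a0 ha] := bounded_nsq bA; have [b b0 hb] := bounded_nsq bB.
have [d d0 hd] := bounded_nsq bD.
apply: (bounded_of_nsq _ (M := a + b + d)) => [c x y|k].
  apply: (f_equal2 pair); rewrite /= (bounded_lin bB, bounded_lin bD)//.
  by rewrite (bounded_lin bA) scalerDr addrACA.
rewrite nsq_block_op nsq_sum; have := ha k.1; have := hb k.2; have := hd k.2.
by have := nsq_ge0 k.1; have := nsq_ge0 k.2; nra.
Qed.

Lemma block_op_upper :
  upper_block (@inl_sum R K1 K2) (@inr_sum R K1 K2) block_op A B D.
Proof.
split=> [x|y].
  rewrite /block_op /= (linear_op0 (bounded_lin bB)) addr0.
  by rewrite (linear_op0 (bounded_lin bD)).
rewrite /block_op /= (linear_op0 (bounded_lin bA)) add0r.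
by apply: (f_equal2 pair); rewrite /= ?addr0 ?add0r.
Qed.

Lemma block_op_lifting : lifting (@inr_sum R K1 K2) block_op D.
Proof. by move=> k; rewrite !adj_inr_sum. Qed.

Lemma adj_mul_eq0 y : adj A (B y) = 0.
Proof. by apply: rip_ext => x; rewrite ripC -adj_rip// AB0 rip0l. Qed.

End BlockOperator.

Lemma iter_lin (R : realType) (K : hilbert R) (S : K -> K) n :
  linear_op S -> linear_op (iter n S).
Proof. by move=> lS; elim: n => // n IH a x y /=; rewrite IH lS. Qed.

(** * The two liftings of a concave operator *)

Section ConcaveLifting.
Variables (R : realType) (H : hilbert R) (T : H -> H).
Hypotheses (bT : bounded_op T) (cT : concave_op T).

Let delta x := nsq (T x) - nsq x.
Let c := opnorm (Delta T).

Let delta_ge0 x : 0 <= delta x.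
Proof. by rewrite subr_ge0 concave_expansive. Qed.

Let delta_le x : delta x <= c * nsq x.
Proof. exact: opnorm_Delta_ub. Qed.

Let deltaT x : delta (T x) <= delta x.
Proof. by have := concave_nsq bT cT x; rewrite /delta; lra. Qed.

Let c_ge0 : 0 <= c.
Proof. exact/opnorm_ge0/Delta_bounded. Qed.

Let delta_herm : herm_form delta.
Proof.
have -> : delta = fun x => nsq (T x) + (-1) * nsq x.
  by apply/funext => x; rewrite /delta; ring.
apply: herm_formD; first exact: herm_form_nsq.
exact/herm_formZ/herm_form_id.
Qed.

Let deltaT_herm : herm_form (fun x => delta (T x)).
Proof.
have -> : (fun x => delta (T x)) = fun x => nsq (T (T x)) + (-1) * nsq (T x).
  by apply/funext => x; rewrite /delta; ring.
apply: herm_formD; first exact/herm_form_nsq/bounded_comp.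
exact/herm_formZ/herm_form_nsq.
Qed.

(** Used for lower bounds on the covariance of a lifting, whose form on [H] dominates [a * delta];
    here [a] is 2 for (i) and 1 for (ii). *)
Lemma opnorm_Delta_le_of_delta a M : 0 < a -> 0 <= M ->
  (forall x, a * delta x <= M * nsq x) -> a * c <= M.
Proof.
move=> a0 M0 h; rewrite mulrC -ler_pdivlMr//; apply: opnorm_Delta_le => //.
  by rewrite divr_ge0// ltW.
move=> x; rewrite -/(delta x) delta_ge0 /= mulrAC ler_pdivlMr// mulrC.
exact: h.
Qed.

Lemma concave_lifting_shifts :
  exists (K Hp H1 H0 : hilbert R) (J : H -> K) (Jp : Hp -> K)
          (I1 : H1 -> Hp) (I0 : H0 -> Hp)
          (S : K -> K) (W : Hp -> Hp) (X : H -> Hp)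
          (Sp1 : H1 -> H1) (Sp0 : H0 -> H0) (E0 : H0 -> H1),
     orth_decomp Jp J /\ bounded_op S /\ lifting J S T /\ two_isometry S /\
     cov S = Num.sqrt 2 * Num.max 1 (Num.sqrt (opnorm (Delta T))) /\
     upper_block Jp J S W X T /\
     bounded_op W /\ bounded_op X /\ two_isometry W /\
     (forall h, adj W (X h) = 0) /\
     orth_decomp I1 I0 /\ nontrivial H1 /\ nontrivial H0 /\
     upper_block I1 I0 W Sp1 (fun b => Complex (Num.sqrt 2) 0 *: E0 b) Sp0 /\
     unilateral_shift Sp1 /\ unilateral_shift Sp0 /\
     bounded_op E0 /\ is_isometry E0.
Proof.
have [Q bQ hQ] := psd_factor delta_herm delta_ge0.
have [X0 bX0 hX0] : exists2 X : H -> H, bounded_op X &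
    forall x, nsq (X x) = delta x + (-1) * delta (T x).
  apply: psd_factor; first exact/herm_formD/herm_formZ.
  by move=> x; have := deltaT x; lra.
(* The line in [G0] makes [H0] nonzero and the summand [H] receives [X0]. In [G1] the summand [H0]
   receives [E0] and the summand [H] receives [Q T], so these two ranges are orthogonal. *)
pose G0 := sum_hilbert (line_hilbert R) H.
pose H0 := ell2_hilbert G0.
pose G1 := sum_hilbert H0 H.
pose H1 := ell2_hilbert G1.
pose E0 (b : H0) : H1 := single (inl_sum H b).
have [bE0 iE0] : bounded_op E0 /\ is_isometry E0.
  apply: isometry_nsq => [a x y|x].
    by rewrite /E0 inl_sum_lin single_lin.
  by rewrite nsq_single nsq_sum nsq0 addr0.
have nE0 b : nsq (E0 b) = nsq b by rewrite nsq_single nsq_sum nsq0 addr0.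
pose s2 : R := Num.sqrt 2.
have s22 : s2 ^+ 2 = 2 by rewrite sqr_sqrtr.
pose E b := s2%:C *: E0 b.
have nE b : nsq (E b) = 2 * nsq b by rewrite nsqZr nE0 s22.
have bE : bounded_op E.
  apply: (bounded_of_nsq _ (M := 2)) => [a x y|x]; last by rewrite nE.
  by rewrite /E (bounded_lin bE0) scalerDr !scalerA mulrC.
have [bS1 _] := isometry_nsq (@shift_lin R G1) (@nsq_shift R G1).
have [bS0 _] := isometry_nsq (@shift_lin R G0) (@nsq_shift R G0).
have sE0 x y : rip (shift x : H1) (E y) = 0 by rewrite ripZr rip_shift_single mulr0.
pose W := block_op (@shift R G1) E (@shift R G0).
have bW : bounded_op W by exact: block_op_bounded.
have nW k : nsq (W k) = nsq k.1 + 3 * nsq k.2.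
  by rewrite nsq_block_op// !nsq_shift nE; ring.
pose X (h : H) : sum_hilbert H1 H0 :=
  (single (inr_sum H0 (Q (T h))), single (inr_sum (line_hilbert R) (X0 h))).
have nX h : nsq (X h) = delta h.
  by rewrite nsq_sum !nsq_single !nsq_sum !nsq0 !add0r /= hQ hX0; ring.
have bX : bounded_op X.
  apply: (bounded_of_nsq _ (M := c)) => [a x y|x]; last by rewrite nX.
  apply: (f_equal2 pair); rewrite /= -single_lin -inr_sum_lin.
    by rewrite (bounded_lin bT) (bounded_lin bQ).
  by rewrite (bounded_lin bX0).
have WX k h : rip (W k) (X h) = 0.
  rewrite rip_sum /= rip_shift_single addr0 ripDl rip_shift_single add0r.
  by rewrite ripZl rip_single rip_sum rip0l rip0r addr0 mulr0.
pose S := block_op W X T.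
have bS : bounded_op S by exact: block_op_bounded.
have nS k : nsq (S k) - nsq k = 2 * nsq k.1.2 + 2 * delta k.2.
  by rewrite nsq_block_op// nW nX nsq_sum (nsq_sum k.1) /delta; ring.
have cn : 0 <= opnorm (Delta S) by exact/opnorm_ge0/Delta_bounded.
have nt (K : hilbert R) (x : K) : x != 0 -> 0 < nsq x.
  by move=> x0; rewrite lt_def nsq_ge0 andbT; apply: contra_neq x0; exact: nsq_eq0.
have nt' (K : hilbert R) (x : K) : 0 < nsq x -> x != 0.
  by apply: contraTneq => ->; rewrite nsq0 ltxx.
have [e /nt e0] := line_nontrivial R.
(* This vector witnesses that [H0] and [H1] are nontrivial, and later that the form of [S] attains
   the factor 2 on [H0]. *)
pose z : H0 := single (inl_sum H e).
have z0 : 0 < nsq z by rewrite nsq_single nsq_sum nsq0 addr0.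
have SM : opnorm (Delta S) = 2 * Num.max 1 c.
  have M1 : 1 <= Num.max 1 c by rewrite le_max lexx.
  have M2 : c <= Num.max 1 c by rewrite le_max lexx orbT.
  apply/eqP; rewrite eq_le; apply/andP; split.
    apply: opnorm_Delta_le => //; first by lra.
    move=> k; rewrite nS; apply/andP; split.
      by have := nsq_ge0 k.1.2; have := delta_ge0 k.2; lra.
    rewrite nsq_sum (nsq_sum k.1); have := delta_le k.2.
    have := nsq_ge0 k.1.1; have := nsq_ge0 k.1.2; have := nsq_ge0 k.2.
    by nra.
  (* Lower bound: testing at [z] gives the entry 1 of the maximum, and testing on [H] gives the
     entry [c]. *)
  rewrite mulrC -ler_pdivlMr// ge_max; apply/andP; split.
    have := opnorm_Delta_ub bS (inl_sum H (inr_sum H1 z)).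
    rewrite nS nsq_sum (nsq_sum (inr_sum H1 z)) /= /delta.
    rewrite (linear_op0 (bounded_lin bT)) !nsq0 subrr mulr0 !addr0 add0r.
    by rewrite ler_pM2r// ler_pdivlMr// mul1r.
  rewrite ler_pdivlMr// mulrC; apply: opnorm_Delta_le_of_delta => // h.
  have := opnorm_Delta_ub bS (inr_sum _ h).
  by rewrite nS nsq_sum /= !nsq0 mulr0 !add0r.
exists (sum_hilbert (sum_hilbert H1 H0) H), (sum_hilbert H1 H0), H1, H0,
  (@inr_sum _ _ _), (@inl_sum _ _ _), (@inl_sum _ _ _), (@inr_sum _ _ _),
  S, W, X, (@shift _ _), (@shift _ _), E0.
have iso2 : two_isometry S.
  apply: two_isometry_nsq => // k.
  have h1 := nS k; have h2 := nS (S k).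
  (* The [H0] component gains exactly what [delta] loses when [T] is applied, so the form is
     invariant under [S]. *)
  have h3 : nsq (S k).1.2 = nsq k.1.2 + nsq (X0 k.2).
    rewrite /S /= nsqD nsq_shift nsq_single nsq_sum nsq0 add0r.
    by rewrite rip_shift_single mulr0 addr0.
  have h4 : delta (S k).2 = delta (T k.2) by [].
  by rewrite h3 h4 hX0 in h2; lra.
have isoW : two_isometry W.
  apply: two_isometry_nsq => // k; rewrite !nW.
  have h1 : nsq (W k).1 = nsq k.1 + 2 * nsq k.2.
    by rewrite nsqD sE0 nsq_shift nE mulr0 addr0.
  have h2 : nsq (W k).2 = nsq k.2 by exact: nsq_shift.
  by rewrite h1 h2 (nsq_sum k); ring.
split; first exact: sum_orth_decomp.
split=> //; split; first exact: block_op_lifting.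
split=> //; split.
  rewrite /cov SM sqrtrM//; congr (_ * _).
  (* The square root is monotone and fixes 1, so it commutes with the maximum. *)
  have [c1|c1] := leP c 1.
    rewrite sqrtr1 max_l// -[X in _ <= X](sqrtr1 R).
    by rewrite ler_wsqrtr.
  rewrite max_r// -[X in X <= _](sqrtr1 R).
  by rewrite ler_wsqrtr// ltW.
split; first exact: block_op_upper.
split=> //; split=> //; split=> //; split; first exact: adj_mul_eq0.
split; first exact: sum_orth_decomp.
split; first by exists (E0 z); apply: nt'; rewrite nE0.
split; first by exists z; exact: nt'.
split; first exact: block_op_upper.
split; first exact: shift_unilateral.
by split; first exact: shift_unilateral.
Qed.

Lemma concave_lifting_minimal :
  exists (K Hp : hilbert R) (J : H -> K) (Jp : Hp -> K)
          (S : K -> K) (W : Hp -> Hp) (X : H -> Hp),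
     orth_decomp Jp J /\ bounded_op S /\ lifting J S T /\ minimal_lifting J S /\
     two_isometry S /\ upper_block Jp J S W X T /\
     bounded_op W /\ bounded_op X /\ is_isometry W /\
     (forall h, adj W (X h) = 0) /\
     cov S = Num.sqrt (opnorm (Delta T)).
Proof.
have [Q0 bQ0 hQ0] : exists2 X : H -> H, bounded_op X &
    forall x, nsq (X x) = c * delta x.
  by apply: psd_factor => [|x]; [exact: herm_formZ | exact: mulr_ge0].
have [Z bZ hZ] : exists2 X : H -> H, bounded_op X &
    forall x, nsq (X x) = c * nsq x + (-1) * delta x.
  apply: psd_factor => [|x]; last by have := delta_le x; lra.
  by apply: herm_formD; apply: herm_formZ => //; exact: herm_form_id.
(* The left side equals [c * nsq (T x) - delta x], so this is [delta (T x) <= delta x]. *)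
have Q0Z x : nsq (Q0 x) + nsq (Z x) <= nsq (Z (T x)).
  by rewrite hQ0 !hZ; have := deltaT x; rewrite /delta; lra.
have [Q [bQ QZ QT]] := backward_column bT bZ bQ0 Q0Z.
(* This is the root of [d - delta] for [d x = c * nsq x - nsq (Q x)]; nonnegativity is
   [nsq (Q x) <= nsq (Z x)]. *)
have [X0 bX0 hX0] : exists2 X : H -> H, bounded_op X &
    forall x, nsq (X x) = c * nsq x + (-1) * delta x + (-1) * nsq (Q x).
  apply: psd_factor => [|x]; last by have := QZ x; rewrite hZ; lra.
  apply: herm_formD; last exact/herm_formZ/herm_form_nsq.
  by apply: herm_formD; apply: herm_formZ => //; exact: herm_form_id.
(* The double orthogonal complement is the closed range of [X0]. *)
pose G := orth_hilbert (orth (range_of X0)).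
have XP h : in_orth (orth (range_of X0)) (X0 h).
  apply/asboolP => y hy; rewrite hinner_conj hy ?conjc0//; by exists h.
pose X1 h : G := OrthType (XP h).
have lX1 : linear_op X1.
  move=> a x y; apply: val_inj; apply: (etrans (bounded_lin bX0 a x y)).
  exact/esym/(orth_val_lin a (X1 x) (X1 y)).
pose X h : ell2_hilbert G := single (X1 h).
have nX h : nsq (X h) = nsq (X0 h) by rewrite nsq_single.
have bX : bounded_op X.
  have [M M0 hM] := bounded_nsq bX0.
  apply: (bounded_of_nsq _ (M := M)) => [a x y|x]; last by rewrite nX.
  by rewrite /X lX1 single_lin.
have [bW iW] := isometry_nsq (@shift_lin R G) (@nsq_shift R G).
have WX u h : rip (shift u) (X h) = 0 by exact: rip_shift_single.
pose S := block_op (@shift R G) X T.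
have bS : bounded_op S by exact: block_op_bounded.
pose d h := c * nsq h - nsq (Q h).
have nS k : nsq (S k) - nsq k = d k.2.
  by rewrite nsq_block_op// nsq_shift nX hX0 nsq_sum /d /delta; ring.
have d_ge h : delta h <= d h.
  by have := nsq_ge0 (X0 h); rewrite hX0 /d; lra.
have iso2 : two_isometry S.
  apply: two_isometry_nsq => // k; have h1 := nS k; have h2 := nS (S k).
  (* Passing from [h] to [T h] adds [c * delta h] to both terms of [d], so their difference is
     unchanged. *)
  have h3 : d (S k).2 = d k.2 by rewrite /d /= QT hQ0 /delta; ring.
  by rewrite h3 in h2; lra.
exists (sum_hilbert (ell2_hilbert G) H), (ell2_hilbert G),
  (@inr_sum _ _ _), (@inl_sum _ _ _), S, (@shift _ _), X.
have ub : upper_block (@inl_sum _ _ _) (@inr_sum _ _ _) S (@shift _ _) X T.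
  exact: block_op_upper.
split; first exact: sum_orth_decomp.
split=> //; split; first exact: block_op_lifting.
split.
  apply: dense_of_orth => -[u h0] hx.
  have orth0 n h : rip ((u, h0) : sum_hilbert (ell2_hilbert G) H)
      (iter n S (inr_sum _ h)) = 0.
    by rewrite /rip hx//; exists n, h.
  have -> : h0 = 0.
    by apply: nsq_eq0; have := orth0 0%N h0; rewrite rip_sum /= rip0r add0r.
  have -> // : u = 0.
  apply: ell2_ext => n; rewrite ell2_zeroE.
  have iterl (v : ell2_hilbert G) : iter n S (inl_sum H v) =
      inl_sum H (iter n (@shift R G) v).
    by elim: n => //= n ->; rewrite ub.1.
  (* Apply [S] once: [S^(n+1) h] is [S^n X h + S^n T h], and the second summand is already
     orthogonal to the vector. What remains pairs [X1 h] with coordinate [n] of [u], which lies in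
     the closed range of [X0] and so is zero. *)
  have h1 h : rip (X1 h) (ell2_val u n) = 0.
    rewrite -rip_iter_shift ripC.
    have := orth0 n.+1 h; rewrite iterSr ub.2.
    rewrite (linear_opD (iter_lin n (bounded_lin bS))) ripDr orth0 addr0.
    by rewrite iterl rip_sum /= rip0r addr0.
  have h2 h : rip (X0 h) (orth_val (ell2_val u n)) = 0 by exact: h1.
  apply: val_inj; apply: hinner_eq0 => /=.
  have /asboolP := orth_valP (ell2_val u n); apply=> _ [h ->].
  by apply: rip_eq0; rewrite -?(linear_opZ (bounded_lin bX0)) ripC h2.
split=> //; split=> //; split=> //; split=> //; split=> //.
split; first exact: adj_mul_eq0.
(* The form [d] lies between [delta] and [c * nsq]; each bound gives one inequality. *)
rewrite /cov; congr Num.sqrt; apply/eqP; rewrite eq_le; apply/andP; split.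
  apply: opnorm_Delta_le => // k; rewrite nS; apply/andP; split.
    exact: le_trans (delta_ge0 _) (d_ge _).
  rewrite -/c nsq_sum /d; have := nsq_ge0 (Q k.2).
  by have := mulr_ge0 c_ge0 (nsq_ge0 k.1); lra.
rewrite -[X in X <= _]mul1r; apply: opnorm_Delta_le_of_delta => //.
  exact/opnorm_ge0/Delta_bounded.
move=> h; rewrite mul1r; apply: (le_trans (d_ge h)).
have := opnorm_Delta_ub bS (inr_sum _ h).
by rewrite nS nsq_sum /= nsq0 add0r.
Qed.

End ConcaveLifting.

Theorem theorem2p1 (R : realType) (H : hilbert R) (T : H -> H) :
  bounded_op T -> concave_op T ->
  (* (i) *)
  (exists (K Hp H1 H0 : hilbert R) (J : H -> K) (Jp : Hp -> K)
          (I1 : H1 -> Hp) (I0 : H0 -> Hp)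
          (S : K -> K) (W : Hp -> Hp) (X : H -> Hp)
          (Sp1 : H1 -> H1) (Sp0 : H0 -> H0) (E0 : H0 -> H1),
     orth_decomp Jp J /\ bounded_op S /\ lifting J S T /\ two_isometry S /\
     cov S = Num.sqrt 2 * Num.max 1 (Num.sqrt (opnorm (Delta T))) /\
     upper_block Jp J S W X T /\
     bounded_op W /\ bounded_op X /\ two_isometry W /\
     (forall h, adj W (X h) = 0) /\
     orth_decomp I1 I0 /\ nontrivial H1 /\ nontrivial H0 /\
     upper_block I1 I0 W Sp1 (fun b => Complex (Num.sqrt 2) 0 *: E0 b) Sp0 /\
     unilateral_shift Sp1 /\ unilateral_shift Sp0 /\
     bounded_op E0 /\ is_isometry E0) /\
  (* (ii) *)
  (exists (K Hp : hilbert R) (J : H -> K) (Jp : Hp -> K)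
          (S : K -> K) (W : Hp -> Hp) (X : H -> Hp),
     orth_decomp Jp J /\ bounded_op S /\ lifting J S T /\ minimal_lifting J S /\
     two_isometry S /\ upper_block Jp J S W X T /\
     bounded_op W /\ bounded_op X /\ is_isometry W /\
     (forall h, adj W (X h) = 0) /\
     cov S = Num.sqrt (opnorm (Delta T))).
Proof.
move=> bT cT.
by split; [exact: concave_lifting_shifts | exact: concave_lifting_minimal].
Qed.
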